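(* Let $1\le M\le L$. Consider rapidities $(\mu_m,x_m)$, $(\nu_m,y_m)$, $1\le m\le M$, and inhomogeneities $(\xi_k,z_k)$, $1\le k\le L$, all complex with nonzero entries, generic in the sense specified in the context, and suppose that $\{\nu\}$ satisfies the Bethe equations $$\prod_{k=1}^L\frac{\xi_k-\nu_j}{\xi_k-\nu_j\rho}\prod_{\substack{m=1\\ m\neq j}}^M(\nu_m-\nu_j\rho)=\rho^{-L/2}\prod_{k=1}^Lz_k\prod_{\substack{m=1\\ m\ne j}}^M(\nu_m\rho-\nu_j),\qquad j=1,\dots,M.$$ Then the scalar product $$\mathcal S=\langle1|\,B_{1\dots L}(\mu_1,x_1)\cdots B_{1\dots L}(\mu_M,x_M)\,C_{1\dots L}(\nu_M,y_M)\cdots C_{1\dots L}(\nu_1,y_1)\,|1\rangle$$ equals $$\mathcal S=\frac{\prod_{n=1}^Lz_n^M}{\prod_{m=1}^M(x_my_m)^{L+\frac12-m}}\cdot\frac{\rho^{\frac{M(L-M)}2}\prod_{k=1}^M\sqrt{\mu_k\nu_k}}{\prod_{1\le q<l\le M}(\mu_l-\mu_q)(\nu_q-\nu_l)}\ \det\big[\mathcal H_{ij}\big]_{i,j=1,\dots,M},$$ where $$\mathcal H_{ij}=\frac{\rho-1}{\nu_i-\mu_j}\left\{\rho^{-\frac L2}\prod_{k=1}^Lz_k\prod_{\substack{m=1\\ m\ne i}}^M(\nu_m\rho-\mu_j)-\prod_{k=1}^L\frac{\mu_j-\xi_k}{\mu_j\rho-\xi_k}\prod_{\substack{m=1\\ m\neq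 i}}^M(\nu_m-\mu_j\rho)\right\}.$$
   Context: Fix $\rho\in\mathbb C\setminus\{0,1\}$. Spectral parameters are pairs $\lambda=(\mu,x)$; for $\lambda=(\mu,x)$, $\lambda'=(\xi,z)$ the $R$-matrix is, in the ordered basis $(e_1\otimes e_1,e_1\otimes e_2,e_2\otimes e_1,e_2\otimes e_2)$ of $\mathbb C^2\otimes\mathbb C^2$, $$R(\lambda,\lambda')=\begin{pmatrix}1&0&0&0\\ 0&\frac{\sqrt\rho}{x}\frac{\mu-\xi}{\mu\rho-\xi}&(\rho-1)\sqrt{\frac zx}\frac{\sqrt{\mu\xi}}{\mu\rho-\xi}&0\\ 0&(\rho-1)\sqrt{\frac zx}\frac{\sqrt{\mu\xi}}{\mu\rho-\xi}&\sqrt\rho\,z\frac{\mu-\xi}{\mu\rho-\xi}&0\\ 0&0&0&\frac zx\end{pmatrix}.$$ Square roots of $\rho$ and of each $\mu_m,\nu_m,\xi_k,x_m,y_m,z_k$ are fixed once and for all; $\sqrt{z/x}=\sqrt z/\sqrt x$, $\sqrt{\mu\xi}=\sqrt\mu\sqrt\xi$, and half-integer powers mean the corresponding powers of these fixed roots. $R_{ai}$ acts as $R$ on $V_a\otimes V_i$ (first factor $V_a$), $V_a,V_i\cong\mathbb C^2$. The monodromy matrix is $R_{aL}((\mu,x),(\xi_L,z_L))\cdots R_{a1}((\mu,x),(\xi_1,z_1))=\begin{pmatrix}A_{1\dots L}(\mu,x)&B_{1\dots L}(\mu,x)\\ C_{1\dots L}(\mu,x)&D_{1\dots L}(\mu,x)\end{pmatrix}_a$,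 a $2\times 2$ matrix in $V_a$ with entries in $\mathrm{End}(V_1\otimes\dots\otimes V_L)$. $|1\rangle=\bigotimes_{i=1}^Le_2$ and $\langle1|$ is its transpose. Genericity: the $\mu_m$ are pairwise distinct, the $\nu_m$ are pairwise distinct, the $\xi_k$ are pairwise distinct, $\mu_i\ne\nu_j$, $\mu_i\neq\xi_k$, $\nu_i\ne\xi_k$, $\mu_i\rho\neq\xi_k$, $\nu_i\rho\ne\xi_k$, and $\xi_j\rho\ne\xi_k$ for $j\neq k$. *)

(* Defs.v *)
From mathcomp Require Export all_boot all_order all_algebra.
From mathcomp Require Export reals mxtens complex.
Set Implicit Arguments.
Unset Strict Implicit.
Unset Printing Implicit Defensive.

Import GRing.Theory.
Local Open Scope ring_scope.

(* A spectral parameter (u, x) together with the chosen square roots of u and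
   of x.  Nothing is assumed here: that the last two fields square to the first
   two is a hypothesis wherever parameters are used. *)
Record spectral (C : Type) := Spectral {
  rapidity : C;
  twist : C;
  sqrt_rapidity : C;
  sqrt_twist : C
}.

(* The R-matrix R(l, l').  The index (a, i) of e_(a+1) (x) e_(i+1) is
   mxtens_index (a, i) = 2 * a + i, that is, the ordered basis is
   e1 (x) e1, e1 (x) e2, e2 (x) e1, e2 (x) e2.  [s] is the chosen square root
   of [rho]. *)
Definition Rmatrix (C : fieldType) (rho s : C) (l l' : spectral C) :
    'M[C]_(2 * 2) :=
  let mu := rapidity l in let x := twist l in
  let xi := rapidity l' in let z := twist l' in
  let b1 := s / x * ((mu - xi) / (mu * rho - xi)) in
  let b2 := s * z * ((mu - xi) / (mu * rho - xi)) in
  let c := (rho - 1) * (sqrt_twist l' / sqrt_twist l)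
           * (sqrt_rapidity l * sqrt_rapidity l' / (mu * rho - xi)) in
  \matrix_(i, j)
    nth 0 (nth [::] [:: [:: 1; 0;  0;  0];
                        [:: 0; b1; c;  0];
                        [:: 0; c;  b2; 0];
                        [:: 0; 0;  0;  z / x]] i) j.

(* End(V_1 (x) ... (x) V_L), V_k = C^2: matrices acting on column vectors, whose
   rows and columns are indexed (through enum_rank) by the basis vectors
   e_(s 1) (x) ... (x) e_(s L), one for each s : {ffun 'I_L -> 'I_2}. *)
Definition qop (C : fieldType) (L : nat) :=
  'M[C]_#|{: {ffun 'I_L -> 'I_2}}|.

(* A acting on the k-th tensor factor, the identity on the others. *)
Definition site_op (C : fieldType) (L : nat) (k : 'I_L) (A : 'M[C]_2) :
    qop C L :=
  \matrix_(i, j)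
    let s := enum_val i : {ffun 'I_L -> 'I_2} in
    let t := enum_val j : {ffun 'I_L -> 'I_2} in
    if [forall k' : 'I_L, (k' != k) ==> (s k' == t k')]
    then A (s k) (t k) else 0.

(* R_{ak} as a 2 x 2 matrix in V_a with entries in End(V_1 (x) ... (x) V_L): for
   R = \sum_(a, b) E_ab (x) R^(ab), the entry (a, b) is R^(ab) at site k. *)
Definition Raux (C : fieldType) (rho s : C) (L : nat)
    (l : spectral C) (inh : 'I_L -> spectral C) (k : 'I_L) : 'M[qop C L]_2 :=
  \matrix_(a, b)
    site_op k (\matrix_(i, j)
      Rmatrix rho s l (inh k) (mxtens_index (a, i)) (mxtens_index (b, j))).

(* R_{aL} ... R_{a1}, the factor of the last site being leftmost. *)
Definition monodromy (C : fieldType) (rho s : C) (L : nat)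
    (l : spectral C) (inh : 'I_L -> spectral C) : 'M[qop C L]_2 :=
  \prod_(k <- rev (enum 'I_L)) Raux rho s l inh k.

Definition Bop (C : fieldType) (rho s : C) (L : nat)
    (inh : 'I_L -> spectral C) (l : spectral C) : qop C L :=
  monodromy rho s l inh 0 1.

Definition Cop (C : fieldType) (rho s : C) (L : nat)
    (inh : 'I_L -> spectral C) (l : spectral C) : qop C L :=
  monodromy rho s l inh 1 0.

(* |1> = e_2 (x) ... (x) e_2; e_2 has index 1 in 'I_2. *)
Definition ket1 (C : fieldType) (L : nat) :
    'cV[C]_#|{: {ffun 'I_L -> 'I_2}}| :=
  \col_i ((enum_val i : {ffun 'I_L -> 'I_2}) == [ffun=> 1])%:R.

(* <1| B(l_1) ... B(l_M) C(l'_M) ... C(l'_1) |1>. *)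
Definition scalar_product (C : fieldType) (rho s : C) (L M : nat)
    (inh : 'I_L -> spectral C) (l l' : 'I_M -> spectral C) : C :=
  ((ket1 C L)^T
   *m (\prod_(m <- enum 'I_M) Bop rho s inh (l m) : qop C L)
   *m (\prod_(m <- rev (enum 'I_M)) Cop rho s inh (l' m) : qop C L)
   *m ket1 C L) 0 0.

(* Main.v *)
(* A diagonal gauge transformation removes the twists x, z and all square roots;
   only Z = prod_k z_k survives, through kappa = rho^(-L/2) Z in the Bethe
   equations.  Multiplied by its denominators, the scalar product is then a
   polynomial of degree less than L in each mu_j, and the determinant divided by
   the Vandermonde product of the mu_j is one as well, since the Bethe equations
   cancel the poles at mu_j = nu_i.  Following Korepin, Izergin and Wheeler, the
   rapidities mu_j are specialized one by one to inhomogeneities: mu_j = xi_k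
   freezes the site k, and after that the scalar product vanishes when another
   rapidity equals xi_k / rho.  This gives enough points for Lagrange
   interpolation.  When all mu_j are inhomogeneities the scalar product factors
   through the domain wall partition function, which is Izergin's determinant;
   there the Bethe equations enter only through kappa^M. *)
Require Import Defs.
From mathcomp Require Import perm ring zify.
Set Implicit Arguments.
Unset Strict Implicit.
Unset Printing Implicit Defensive.
Import GRing.Theory.
Local Open Scope ring_scope.

(** * Operators acting on one or two sites *)

(** Correlators are row vectors pushed to the right through operators, over a list of sites:
    freezing removes the leftmost site, and what remains is an object of the same kind on the tail.
    No exchange relation between [B] or [C] operators at different rapidities is used. The only
    Yang-Baxter relation exchanges two sites; it brings any chosen site to the front, at the price
    of the vacuum eigenvalue [xi k * rho - xi l], which genericity keeps away from 0.

    The interpolation count is tight. After multiplication by the Vandermonde product both sides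
    have degree below L + M - 1 in one free rapidity.

    Genericity allows [nu m = nu i * rho], so the product of all Bethe equations may read 0 = 0 and
    need not give [kappa ^+ M]. The identity for [kappa ^+ M] is therefore stated only after
    multiplication by Izergin's determinant. *)

Section SiteOp.
Variables (F : fieldType) (L : nat).
Notation conf := {ffun 'I_L -> 'I_2}.
Notation op := (qop F L).
Implicit Types (k l : 'I_L) (A B : 'M[F]_2) (s t : conf).

Definition upd s k (c : 'I_2) : conf := [ffun q => if q == k then c else s q].

Lemma sum_site k s (f : conf -> F) :
  \sum_(t : conf) (if [forall q, (q != k) ==> (s q == t q)] then f t else 0)
  = \sum_c f (upd s k c).
Proof.
rewrite -big_mkcond /= (reindex_onto (upd s k) (fun t : conf => t k)) /=.
  apply: eq_bigl => c; rewrite !ffunE !eqxx andbT.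
  by apply/forallP => q; rewrite ffunE; apply/implyP => /negbTE ->.
move=> t /forallP st; apply/ffunP => q; rewrite ffunE.
by case: eqP => [-> //|/eqP qk]; have /implyP/(_ qk)/eqP := st q.
Qed.

Lemma site_opE k A s t :
  site_op k A (enum_rank s) (enum_rank t)
  = if [forall q, (q != k) ==> (s q == t q)] then A (s k) (t k) else 0.
Proof. by rewrite mxE !enum_rankK. Qed.

Lemma op_ext (n : nat) (X Y : 'M[F]_(#|{: conf}|, n)) :
  (forall s j, X (enum_rank s) j = Y (enum_rank s) j) -> X = Y.
Proof. by move=> XY; apply/matrixP => i j; rewrite -(enum_valK i) XY. Qed.

Lemma op2_ext (X Y : op) :
  (forall s t, X (enum_rank s) (enum_rank t) = Y (enum_rank s) (enum_rank t)) ->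
  X = Y.
Proof. by move=> XY; apply: op_ext => s j; rewrite -(enum_valK j) XY. Qed.

Lemma mulmx_conf (m n : nat) (X : 'M[F]_(m, #|{: conf}|))
    (Y : 'M[F]_(#|{: conf}|, n)) i j :
  (X *m Y) i j = \sum_(t : conf) X i (enum_rank t) * Y (enum_rank t) j.
Proof.
rewrite mxE (reindex enum_rank) //=.
by apply: onW_bij; exact: enum_rank_bij.
Qed.

Lemma site_op_mull k A (n : nat) (X : 'M[F]_(#|{: conf}|, n)) s j :
  (site_op k A *m X) (enum_rank s) j
  = \sum_c A (s k) c * X (enum_rank (upd s k c)) j.
Proof.
rewrite mulmx_conf.
under eq_bigr => t _ do rewrite site_opE (fun_if (fun a => a * _)) mul0r.
rewrite (sum_site k s (fun t => A (s k) (t k) * X (enum_rank t) j)).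
by apply: eq_bigr => c _; rewrite ffunE eqxx.
Qed.

Lemma site_op_mulr k A (m : nat) (X : 'M[F]_(m, #|{: conf}|)) i t :
  (X *m site_op k A) i (enum_rank t)
  = \sum_c X i (enum_rank (upd t k c)) * A c (t k).
Proof.
rewrite mulmx_conf.
transitivity (\sum_(s : conf) (if [forall q, (q != k) ==> (t q == s q)]
    then X i (enum_rank s) * A (s k) (t k) else 0)); last first.
  rewrite (sum_site k t (fun s => X i (enum_rank s) * A (s k) (t k))).
  by apply: eq_bigr => c _; rewrite ffunE eqxx.
apply: eq_bigr => s _; rewrite site_opE.
rewrite (_ : [forall q, _] = [forall q, (q != k) ==> (t q == s q)]).
  by case: ifP; rewrite ?mulr0.
by apply: eq_forallb => q; rewrite (eq_sym (s q)).
Qed.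

Lemma site_op_linear k (a : F) A B :
  site_op k (a *: A + B) = a *: site_op k A + site_op k B.
Proof.
apply: op2_ext => s t; rewrite site_opE [RHS]mxE [X in _ = X + _]mxE !site_opE.
by case: ifP => _; rewrite ?mulr0 ?addr0 // !mxE.
Qed.

Lemma site_op0 k : site_op k 0 = 0 :> op.
Proof. by apply: op2_ext => s t; rewrite site_opE !mxE if_same. Qed.

Lemma site_opD k A B : site_op k (A + B) = site_op k A + site_op k B.
Proof. by have := site_op_linear k 1 A B; rewrite !scale1r. Qed.

Lemma site_opZ k (a : F) A : site_op k (a *: A) = a *: site_op k A.
Proof. by have := site_op_linear k a A 0; rewrite site_op0 !addr0. Qed.

Lemma site_opM k A B : site_op k (A *m B) = site_op k A *m site_op k B :> op.
Proof.
apply: op2_ext => s t; rewrite site_op_mull site_opE.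
have E c : [forall q, (q != k) ==> (upd s k c q == t q)]
         = [forall q, (q != k) ==> (s q == t q)].
  by apply: eq_forallb => q; rewrite ffunE; case: eqP.
under eq_bigr => c _ do rewrite site_opE E ffunE eqxx.
case: ifP => _; first by rewrite mxE.
by rewrite big1 // => c _; rewrite mulr0.
Qed.

Lemma site_op_comm k l A B : k != l ->
  site_op k A *m site_op l B = site_op l B *m site_op k A :> op.
Proof.
move=> kl; apply: op2_ext => s t; rewrite site_op_mull site_op_mulr.
rewrite (bigD1 (t k)) //= [RHS](bigD1 (s k)) //= !big1 ?addr0; last first.
- move=> c ck; rewrite site_opE; case: ifP; rewrite ?mulr0 // => /forallP/(_ k).
  by rewrite kl ffunE eqxx (negbTE ck).
- move=> c ck; rewrite site_opE; case: ifP; rewrite ?mul0r // => /forallP/(_ k).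
  by rewrite kl ffunE eqxx eq_sym (negbTE ck).
have lk : (l == k) = false by rewrite eq_sym (negbTE kl).
rewrite !site_opE mulrC; congr (_ * _); rewrite !ffunE lk.
rewrite (_ : [forall q, _] = [forall q, (q != l) ==> (s q == upd t k (s k) q)]) //.
apply: eq_forallb => q; rewrite !ffunE; case: (eqVneq q k) => // ->.
by rewrite !eqxx.
Qed.
End SiteOp.

(** * Yang-Baxter equation and exchange of two sites *)

Section Weights.
Variables (F : fieldType) (rho : F).

(* The entry ((a, i), (b, j)) of the R-matrix after a diagonal gauge
   transformation that removes all square roots and twists, multiplied by
   [u * rho - x].  In this gauge the R-matrix still satisfies the Yang-Baxter
   equation and its entries are polynomials in [u]. *)
Definition wt (u x : F) (a i b j : nat) : F :=
  match a, i, b, j with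
  | O, O, O, O | S O, S O, S O, S O => u * rho - x
  | O, S O, O, S O => u - x
  | S O, O, S O, O => rho * (u - x)
  | O, S O, S O, O => (rho - 1) * x
  | S O, O, O, S O => (rho - 1) * u
  | _, _, _, _ => 0
  end.

Lemma ord2_ind (P : 'I_2 -> Prop) : P 0 -> P 1 -> forall i, P i.
Proof.
move=> P0 P1 [[|[|//]] p].
  by rewrite (_ : Ordinal p = 0) //; apply: val_inj.
by rewrite (_ : Ordinal p = 1) //; apply: val_inj.
Qed.

(** The auxiliary line crosses two sites with inhomogeneities [x] and [y], and the weights at
    [(x, y)] interchange these sites. Each of the 64 index choices is a polynomial identity. *)
Lemma wt_yang_baxter (u x y : F) (a b i j p q : 'I_2) :
  \sum_(r < 2) \sum_(s < 2)
     (\sum_(c < 2) wt u x a i c r * wt u y c j b s) * wt x y r s p q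
  = \sum_(r < 2) \sum_(s < 2)
     wt x y i j r s * (\sum_(c < 2) wt u y a s c q * wt u x c r b p).
Proof.
elim/ord2_ind: a; elim/ord2_ind: b; elim/ord2_ind: i; elim/ord2_ind: j;
  elim/ord2_ind: p; elim/ord2_ind: q; rewrite !big_ord_recl !big_ord0 /=; ring.
Qed.
End Weights.

Section PairOp.
Variables (F : fieldType) (L : nat).
Notation conf := {ffun 'I_L -> 'I_2}.
Notation op := (qop F L).
Implicit Types (s t : conf) (f g : 'I_2 -> 'I_2 -> 'I_2 -> 'I_2 -> F).
Variables (k l : 'I_L).
Hypothesis kl : k != l.

Definition pair_op f : op :=
  \matrix_(i, j)
    let s := enum_val i : conf in let t := enum_val j : conf in
    if [forall q, (q != k) && (q != l) ==> (s q == t q)]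
    then f (s k) (s l) (t k) (t l) else 0.

Lemma pair_opE f s t :
  pair_op f (enum_rank s) (enum_rank t)
  = if [forall q, (q != k) && (q != l) ==> (s q == t q)]
    then f (s k) (s l) (t k) (t l) else 0.
Proof. by rewrite mxE !enum_rankK. Qed.

Lemma eq_pair_op f g :
  (forall i j p q, f i j p q = g i j p q) -> pair_op f = pair_op g.
Proof. by move=> fg; apply: op2_ext => s t; rewrite !pair_opE fg. Qed.

Lemma sum_pair s (f : conf -> F) :
  \sum_(t : conf)
     (if [forall q, (q != k) && (q != l) ==> (s q == t q)] then f t else 0)
  = \sum_c \sum_d f (upd (upd s k c) l d).
Proof.
rewrite pair_bigA -big_mkcond /=.
rewrite (reindex_onto (fun cd => upd (upd s k cd.1) l cd.2)
   (fun t : conf => (t k, t l))) /=.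
  apply: eq_bigl => -[c d]; rewrite !ffunE !eqxx (negbTE kl) eqxx andbT.
  apply/forallP => q; rewrite !ffunE; apply/implyP.
  by case/andP => /negbTE -> /negbTE ->.
move=> t /forallP st; apply/ffunP => q; rewrite !ffunE.
case: eqP => [-> //|/eqP ql]; case: eqP => [-> //|/eqP qk].
by have := st q; rewrite ql qk => /eqP.
Qed.

Lemma pair_opM f g :
  pair_op f *m pair_op g
  = pair_op (fun i j p q => \sum_r \sum_s f i j r s * g r s p q).
Proof.
apply: op2_ext => s t; rewrite mulmx_conf pair_opE.
under eq_bigr => v _ do rewrite pair_opE (fun_if (fun a => a * _)) mul0r.
rewrite (sum_pair s (fun v => f (s k) (s l) (v k) (v l) *
  pair_op g (enum_rank v) (enum_rank t))).
case: ifP => E.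
  apply: eq_bigr => c _; apply: eq_bigr => d _; rewrite pair_opE.
  rewrite (_ : [forall q, _] = true); first by rewrite !ffunE !eqxx (negbTE kl).
  rewrite -E; apply: eq_forallb => q; rewrite !ffunE.
  by case: (q == k); case: (q == l).
rewrite big1 // => c _; rewrite big1 // => d _; rewrite pair_opE.
rewrite (_ : [forall q, _] = false) ?mulr0 //.
rewrite -E; apply: eq_forallb => q; rewrite !ffunE.
by case: (q == k); case: (q == l).
Qed.

Lemma pair_op_site (A B : 'M[F]_2) :
  site_op k A *m site_op l B = pair_op (fun i j p q => A i p * B j q).
Proof.
apply: op2_ext => s t; rewrite site_op_mull pair_opE.
rewrite (bigD1 (t k)) //= big1 ?addr0; last first.
  move=> c ck; rewrite site_opE; case: ifP; rewrite ?mulr0 // => /forallP/(_ k).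
  by rewrite kl ffunE eqxx (negbTE ck).
have lk : (l == k) = false by rewrite eq_sym (negbTE kl).
rewrite site_opE !ffunE lk.
rewrite (_ : [forall q, _] = [forall q, (q != k) && (q != l) ==> (s q == t q)]).
  by case: ifP; rewrite ?mulr0.
apply: eq_forallb => q; rewrite !ffunE; case: (eqVneq q k) => // -> /=.
by rewrite eqxx implybT.
Qed.

Lemma pair_opD f g :
  pair_op f + pair_op g = pair_op (fun i j p q => f i j p q + g i j p q).
Proof.
by apply: op2_ext => s t; rewrite mxE !pair_opE; case: ifP; rewrite ?addr0.
Qed.

Lemma pair_op_comm f m (A : 'M[F]_2) : m != k -> m != l ->
  pair_op f *m site_op m A = site_op m A *m pair_op f.
Proof.
(* Expansion in elementary matrices at [k] and [l] reduces the claim to one-site operators at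
   distinct sites. *)
move=> mk ml; have E : pair_op f = \sum_i \sum_j \sum_p \sum_q f i j p q *:
    (site_op k (delta_mx i p) *m site_op l (delta_mx j q)).
  apply: op2_ext => s t; rewrite pair_opE summxE.
  under eq_bigr => i _ do rewrite summxE.
  under eq_bigr => i _ do under eq_bigr => j _ do rewrite summxE.
  under eq_bigr => i _ do under eq_bigr => j _ do
    under eq_bigr => p _ do rewrite summxE.
  under eq_bigr => i _ do under eq_bigr => j _ do
    under eq_bigr => p _ do under eq_bigr => q _ do
    rewrite mxE pair_op_site pair_opE !mxE.
  case: ifP => _; last first.
    by do 4!(rewrite big1 // => ? _); rewrite mulr0.
  rewrite (bigD1 (s k)) //= (bigD1 (s l)) //= (bigD1 (t k)) //= (bigD1 (t l)) //=.
  rewrite !eqxx /= !mulr1 !big1 ?addr0 // => i /negbTE ik;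
   rewrite ?big1 // => *; rewrite ?big1 // => *; rewrite ?big1 // => *;
   by rewrite ![_ == i]eq_sym ik ?andbF ?(mul0r, mulr0).
rewrite E mulmx_suml mulmx_sumr; apply: eq_bigr => i _.
rewrite mulmx_suml mulmx_sumr; apply: eq_bigr => j _.
rewrite mulmx_suml mulmx_sumr; apply: eq_bigr => p _.
rewrite mulmx_suml mulmx_sumr; apply: eq_bigr => q _.
rewrite -scalemxAl -scalemxAr -mulmxA (site_op_comm _ _ (k := l)) 1?eq_sym //.
by rewrite mulmxA (site_op_comm _ _ (k := k)) 1?eq_sym // -mulmxA.
Qed.
End PairOp.

Lemma sum_ord2 (V : nmodType) (f : 'I_2 -> V) : \sum_c f c = f 0 + f 1.
Proof.
rewrite !big_ord_recl big_ord0 addr0; congr (_ + f _).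
by apply: val_inj.
Qed.

(** * Monodromy matrices over a list of sites *)

Section Monodromy.
Variables (F : fieldType) (rho : F) (L : nat) (xi : 'I_L -> F).
Notation op := (qop F L).
Notation dim := #|{: {ffun 'I_L -> 'I_2}}|.
Implicit Types (k l m : 'I_L) (ks ps qs : seq 'I_L) (u v : F) (us vs : seq F).
Implicit Types (w : 'rV[F]_dim) (a b c : 'I_2).

Definition blk u x a b : 'M[F]_2 := \matrix_(i, j) wt rho u x a i b j.

Definition lax u k : 'M[op]_2 := \matrix_(a, b) site_op k (blk u (xi k) a b).

Definition mon ks u : 'M[op]_2 := \prod_(k <- ks) lax u k.

Lemma mon_nil u a b : mon [::] u a b = if a == b then 1%:M else 0.
Proof. by rewrite /mon big_nil mxE; case: (a == b). Qed.

Lemma mon_cat ks ps u a b :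
  mon (ks ++ ps) u a b = \sum_c mon ks u a c *m mon ps u c b.
Proof. by rewrite /mon big_cat mxE. Qed.

Lemma mon_cons k ks u a b :
  mon (k :: ks) u a b = \sum_c site_op k (blk u (xi k) a c) *m mon ks u c b.
Proof.
by rewrite /mon big_cons mxE; apply: eq_bigr => c _; rewrite [lax _ _ _ _]mxE.
Qed.

Lemma mon_comm (X : op) ks u a b :
  (forall k A, k \in ks -> X *m site_op k A = site_op k A *m X) ->
  X *m mon ks u a b = mon ks u a b *m X.
Proof.
elim: ks a b => [|k ks IH] a b XC.
  by rewrite mon_nil; case: ifP; rewrite ?(mulmx1, mul1mx, mulmx0, mul0mx).
rewrite mon_cons mulmx_sumr mulmx_suml; apply: eq_bigr => c _.
rewrite mulmxA XC ?mem_head // -!mulmxA IH // => l A lks.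
by apply: XC; rewrite inE lks orbT.
Qed.

Lemma site_mon_comm m A ks u a b : m \notin ks ->
  site_op m A *m mon ks u a b = mon ks u a b *m site_op m A.
Proof.
move=> mks; apply: mon_comm => k B kks; apply: site_op_comm.
by apply: contraNneq mks => ->.
Qed.

Lemma mon_mon_comm ks ps u v a b c d : ~~ has (mem ks) ps ->
  mon ks u a b *m mon ps v c d = mon ps v c d *m mon ks u a b.
Proof.
move=> H; apply: mon_comm => k A kps; rewrite site_mon_comm //.
by apply: contra H => kks; apply/hasP; exists k.
Qed.

Definition intertwiner k l : op :=
  pair_op k l (fun i j p q => wt rho (xi k) (xi l) i j p q).

(* Reordering two adjacent sites is conjugation by an operator that fixes both
   vacua up to the same scalar: vacuum correlators do not depend on the order of
   the sites. *)
Lemma mon_exchange k l ps ks u a b :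
  k != l -> k \notin ps ++ ks -> l \notin ps ++ ks ->
  mon (ps ++ k :: l :: ks) u a b *m intertwiner k l
  = intertwiner k l *m mon (ps ++ l :: k :: ks) u a b.
Proof.
rewrite !mem_cat !negb_or => kl /andP[kp kk] /andP[lp lk].
have comm qs c d : k \notin qs -> l \notin qs ->
    intertwiner k l *m mon qs u c d = mon qs u c d *m intertwiner k l.
  move=> kq lq; apply: mon_comm => m A mqs; apply: pair_op_comm => //.
    by apply: contraNneq kq => <-.
  by apply: contraNneq lq => <-.
rewrite !mon_cat mulmx_suml mulmx_sumr; apply: eq_bigr => c _.
rewrite mulmxA comm // -!mulmxA; congr (_ *m _).
rewrite -[k :: l :: ks]/([:: k; l] ++ ks) -[l :: k :: ks]/([:: l; k] ++ ks).
rewrite !mon_cat mulmx_suml mulmx_sumr; apply: eq_bigr => d _.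
rewrite -mulmxA -comm // !mulmxA; congr (_ *m _).
have E2 k1 l1 : mon [:: k1; l1] u c d
    = \sum_e site_op k1 (blk u (xi k1) c e) *m site_op l1 (blk u (xi l1) e d).
  rewrite mon_cons; apply: eq_bigr => e _; rewrite mon_cons.
  rewrite (bigD1 d) //= big1 ?addr0 => [|f fd]; rewrite mon_nil.
    by rewrite eqxx mulmx1.
  by rewrite (negbTE fd) mulmx0.
rewrite !E2 !big_ord_recl !big_ord0 !addr0.
rewrite !(site_op_comm _ _ (k := l) (l := k)) 1?eq_sym //.
rewrite !pair_op_site // !pair_opD !pair_opM //.
apply: eq_pair_op => i j p q.
have := wt_yang_baxter rho u (xi k) (xi l) c d i j p q.
rewrite !big_ord_recl !big_ord0 !addr0 !mxE => ->.
by rewrite ![wt rho u (xi k) _ _ _ _ * wt rho u (xi l) _ _ _ _]mulrC.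
Qed.

(* [w] applied to the product of the entries (a, b) at [us], in this order. *)
Definition mons w ks a b us : 'rV[F]_dim :=
  foldl (fun w u => w *m mon ks u a b) w us.

Lemma mons_cons w ks a b u us :
  mons w ks a b (u :: us) = mons (w *m mon ks u a b) ks a b us.
Proof. by []. Qed.

Lemma mons_cat w ks a b us us' :
  mons w ks a b (us ++ us') = mons (mons w ks a b us) ks a b us'.
Proof. exact: foldl_cat. Qed.

Lemma monsZ (z : F) w ks a b us :
  mons (z *: w) ks a b us = z *: mons w ks a b us.
Proof. by elim: us w => //= u us IH w; rewrite -scalemxAl IH. Qed.

Lemma mons0 ks a b us : mons 0 ks a b us = 0.
Proof. by elim: us => //= u us IH; rewrite mul0mx. Qed.

Lemma mons_exchange w (X : op) ks ps a b us :
  (forall u, mon ps u a b *m X = X *m mon ks u a b) ->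
  mons (w *m X) ks a b us = mons w ps a b us *m X.
Proof.
move=> XC; elim: us w => //= u us IH w.
by rewrite -IH -!mulmxA XC.
Qed.

Definition correl w ks us vs : F :=
  (mons (mons w ks 0 1 us) ks 1 0 vs *m ket1 F L) 0 0.

(* [w] is supported on configurations with e_2 (down) or e_1 (up) at [k]. *)
Definition down k w := w *m site_op k (delta_mx 1 1) = w.
Definition up k w := w *m site_op k (delta_mx 0 0) = w.

Lemma ket_down k : site_op k (delta_mx 1 1) *m ket1 F L = ket1 F L.
Proof.
apply: op_ext => s j.
rewrite site_op_mull (bigD1 1) //= big1 ?addr0 => [|c c1]; last first.
  by rewrite !mxE (negbTE c1) andbF mul0r.
rewrite !mxE !enum_rankK eqxx andbT.
case: (eqVneq s _) => [->|sn].
  rewrite ffunE eqxx mul1r (_ : upd _ _ _ = [ffun=> 1]) ?eqxx //.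
  by apply/ffunP => q; rewrite !ffunE; case: eqP.
case: (eqVneq (s k) 1) => sk; last by rewrite mul0r.
rewrite mul1r; case: eqP => // E; case/eqP: sn; apply/ffunP => q.
have := congr1 (fun f : {ffun _} => f q) E; rewrite !ffunE.
by case: eqP => [->|].
Qed.

Lemma bra_down k : down k (ket1 F L)^T.
Proof.
rewrite /down; apply: trmx_inj; rewrite trmx_mul trmxK.
rewrite -[RHS](ket_down k); congr (_ *m _).
apply: op2_ext => s1 t; rewrite mxE !site_opE !mxE andbC.
rewrite (_ : [forall q, _] = [forall q, (q != k) ==> (s1 q == t q)]) //.
by apply: eq_forallb => q; rewrite (eq_sym (t q)).
Qed.

Lemma down_site k w (A : 'M[F]_2) : down k w ->
  w *m site_op k A = A 1 0 *: (w *m site_op k (delta_mx 1 0)) + A 1 1 *: w.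
Proof.
move=> <-; rewrite -!mulmxA -!site_opM !scalemxAr -mulmxDr -!site_opZ -site_opD.
congr (_ *m site_op k _); apply/matrixP; do 2!apply: ord2_ind;
  rewrite !mxE !sum_ord2 !mxE /=; ring.
Qed.

Lemma up_site k w (A : 'M[F]_2) : up k w ->
  w *m site_op k A = A 0 0 *: w + A 0 1 *: (w *m site_op k (delta_mx 0 1)).
Proof.
move=> <-; rewrite -!mulmxA -!site_opM !scalemxAr -mulmxDr -!site_opZ -site_opD.
congr (_ *m site_op k _); apply/matrixP; do 2!apply: ord2_ind;
  rewrite !mxE !sum_ord2 !mxE /=; ring.
Qed.

Lemma down_up k w : down k w -> up k (w *m site_op k (delta_mx 1 0)).
Proof. by rewrite /up -mulmxA -site_opM mul_delta_mx. Qed.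

Lemma up_down k w : up k w -> down k (w *m site_op k (delta_mx 0 1)).
Proof. by rewrite /down -mulmxA -site_opM mul_delta_mx. Qed.
End Monodromy.

(** Adjacent transpositions connect all orderings, and every intermediate list stays duplicate-free;
    so the swap is needed only for distinct letters, which is the case where two sites have an
    intertwiner. *)
Lemma swap_perm_invariant (T : eqType) (U : Type) (f : seq T -> U) :
  (forall p k l q, uniq (p ++ k :: l :: q) ->
     f (p ++ k :: l :: q) = f (p ++ l :: k :: q)) ->
  forall s t, perm_eq s t -> uniq s -> f s = f t.
Proof.
move=> fswap.
have move_front p a t1 t2 : uniq (p ++ a :: t1 ++ t2) ->
    f (p ++ a :: t1 ++ t2) = f (p ++ t1 ++ a :: t2).
  elim: t1 p => //= b t1 IH p Up.
  rewrite fswap // -[p ++ b :: a :: _]cat_rcons IH -?cat_rcons // !cat_rcons.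
  by rewrite -(perm_uniq (s1 := p ++ a :: b :: t1 ++ t2)) // perm_cat2l
       (perm_catCA [:: a] [:: b]) /= perm_refl.
suff main : forall s t p, perm_eq s t -> uniq (p ++ s) -> f (p ++ s) = f (p ++ t).
  by move=> s t; exact: (main s t [::]).
elim=> [|a s IH] t p.
  by rewrite perm_sym => /perm_nilP ->.
move=> st; have /splitPr : a \in t by rewrite -(perm_mem st) mem_head.
move: st => /[swap] -[t1 t2].
rewrite perm_sym perm_catC perm_cons perm_catC perm_sym => st Up.
rewrite -cat_rcons (IH (t1 ++ t2)) ?cat_rcons //.
apply: move_front; rewrite -(perm_uniq (s1 := p ++ a :: s)) //.
by rewrite perm_cat2l perm_cons.
Qed.

(** * Freezing rapidities at inhomogeneities *)

Section Freezing.
Variables (F : fieldType) (rho : F) (L : nat) (xi : 'I_L -> F).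
Notation op := (qop F L).
Notation dim := #|{: {ffun 'I_L -> 'I_2}}|.
Notation mon := (mon rho xi).
Notation mons := (mons rho xi).
Notation blk := (blk rho).
Notation correl := (correl rho xi).
Implicit Types (k l m : 'I_L) (ks ps qs : seq 'I_L) (u v : F) (us vs : seq F).
Implicit Types (w : 'rV[F]_dim) (a b c : 'I_2).

Lemma blkE u x a b i j : blk u x a b i j = wt rho u x a i b j.
Proof. by rewrite mxE. Qed.

Definition all_down ks w := forall k, k \in ks -> down k w.
Definition all_up ks w := forall k, k \in ks -> up k w.

Lemma down_mul k w (X : op) :
  (forall A, X *m site_op k A = site_op k A *m X) -> down k w -> down k (w *m X).
Proof. by move=> XC; rewrite /down -mulmxA XC mulmxA => ->. Qed.

Lemma up_mul k w (X : op) :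
  (forall A, X *m site_op k A = site_op k A *m X) -> up k w -> up k (w *m X).
Proof. by move=> XC; rewrite /up -mulmxA XC mulmxA => ->. Qed.

Lemma all_down_mon ks ps w u a b : ~~ has (mem ks) ps ->
  all_down ks w -> all_down ks (w *m mon ps u a b).
Proof.
move=> H wD k kks; apply: down_mul (wD k kks) => A; rewrite site_mon_comm //.
by apply: contra H => kps; apply/hasP; exists k.
Qed.

Lemma up_mon k ps w u a b : k \notin ps -> up k w -> up k (w *m mon ps u a b).
Proof. by move=> kps; apply: up_mul => A; rewrite site_mon_comm. Qed.

Lemma down_mon k ps w u a b :
  k \notin ps -> down k w -> down k (w *m mon ps u a b).
Proof. by move=> kps; apply: down_mul => A; rewrite site_mon_comm. Qed.

Lemma all_down_site ks w k A : k \notin ks ->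
  all_down ks w -> all_down ks (w *m site_op k A).
Proof.
move=> kks wD l lks; apply: down_mul (wD l lks) => B; apply: site_op_comm.
by apply: contraNneq kks => ->.
Qed.

Lemma all_up_site ks w k A : k \notin ks ->
  all_up ks w -> all_up ks (w *m site_op k A).
Proof.
move=> kks wD l lks; apply: up_mul (wD l lks) => B; apply: site_op_comm.
by apply: contraNneq kks => ->.
Qed.

Lemma row_mon_cons w k ks u a b :
  w *m mon (k :: ks) u a b
  = w *m site_op k (blk u (xi k) a 0) *m mon ks u 0 b
  + w *m site_op k (blk u (xi k) a 1) *m mon ks u 1 b.
Proof. by rewrite mon_cons sum_ord2 mulmxDr !mulmxA. Qed.

Lemma all_downW k ks w : all_down (k :: ks) w -> down k w /\ all_down ks w.
Proof.
by move=> wD; split => [|l lks]; apply: wD; rewrite inE ?eqxx ?lks ?orbT.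
Qed.

Lemma all_upW k ks w : all_up (k :: ks) w -> up k w /\ all_up ks w.
Proof.
by move=> wD; split => [|l lks]; apply: wD; rewrite inE ?eqxx ?lks ?orbT.
Qed.

(** A site in state e_2 has no weight leading from auxiliary state 1 to 0, so a line entering in
    state 1 never leaves it. *)
Lemma down_mon10 ks w u : uniq ks -> all_down ks w -> w *m mon ks u 1 0 = 0.
Proof.
elim: ks w => [|k ks IH] w; first by rewrite mon_nil mulmx0.
case/andP => kks Uks /all_downW[wk wD].
rewrite row_mon_cons !(down_site (blk _ _ _ _) wk) !blkE /= !scale0r !addr0 add0r mul0mx add0r.
by rewrite -scalemxAl (IH _ Uks wD) scaler0.
Qed.

Lemma down_mon00 ks w u : uniq ks -> all_down ks w ->
  w *m mon ks u 0 0 = (\prod_(k <- ks) (u - xi k)) *: w.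
Proof.
elim: ks w => [|k ks IH] w; first by move=> *; rewrite mon_nil mulmx1 big_nil scale1r.
case/andP => kks Uks /all_downW[wk wD].
rewrite row_mon_cons !(down_site (blk _ _ _ _) wk) !blkE /= !scale0r addr0 add0r.
rewrite -!scalemxAl (IH _ Uks wD) down_mon10; last exact: all_down_site.
  by rewrite scaler0 addr0 scalerA big_cons.
by [].
Qed.

Lemma down_mon11 ks w u : uniq ks -> all_down ks w ->
  w *m mon ks u 1 1 = (\prod_(k <- ks) (u * rho - xi k)) *: w.
Proof.
elim: ks w => [|k ks IH] w; first by move=> *; rewrite mon_nil mulmx1 big_nil scale1r.
case/andP => kks Uks /all_downW[wk wD].
rewrite row_mon_cons !(down_site (blk _ _ _ _) wk) !blkE /= !scale0r !add0r mul0mx add0r.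
by rewrite -!scalemxAl (IH _ Uks wD) scalerA big_cons.
Qed.

Lemma up_mon00 ks w u : all_up ks w ->
  w *m mon ks u 0 0 = (\prod_(k <- ks) (u * rho - xi k)) *: w.
Proof.
elim: ks w => [|k ks IH] w; first by move=> *; rewrite mon_nil mulmx1 big_nil scale1r.
case/all_upW => wk wD.
rewrite row_mon_cons !(up_site (blk _ _ _ _) wk) !blkE /= !scale0r !addr0 mul0mx addr0.
by rewrite -!scalemxAl (IH _ wD) scalerA big_cons.
Qed.

(** From auxiliary state 0 a site in state e_1 permits only the diagonal weight [u * rho - xi k], so
    it decouples from every later operator. *)
Lemma mons01_up k ks w us : k \notin ks -> up k w ->
  mons w (k :: ks) 0 1 us
  = (\prod_(u <- us) (u * rho - xi k)) *: mons w ks 0 1 us.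
Proof.
move=> kks; elim: us w => [|u us IH] w wk; first by rewrite big_nil scale1r.
rewrite !mons_cons row_mon_cons !(up_site (blk _ _ _ _) wk) !blkE /= !scale0r !addr0 mul0mx addr0.
by rewrite -scalemxAl monsZ (IH _ (up_mon _ _ _ kks wk)) scalerA big_cons.
Qed.

Lemma mons10_down k ks w vs : k \notin ks -> down k w ->
  mons w (k :: ks) 1 0 vs
  = (\prod_(v <- vs) (v * rho - xi k)) *: mons w ks 1 0 vs.
Proof.
move=> kks; elim: vs w => [|v vs IH] w wk; first by rewrite big_nil scale1r.
rewrite !mons_cons row_mon_cons !(down_site (blk _ _ _ _) wk) !blkE /=.
rewrite !scale0r !add0r mul0mx add0r.
by rewrite -scalemxAl monsZ (IH _ (down_mon _ _ _ kks wk)) scalerA big_cons.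
Qed.

(* At [u = xi k] the weight [u - xi k] vanishes, so the leftmost site [k] has to
   flip; once flipped it only multiplies the later operators by scalars. *)
Lemma mons01_freeze k ks w us : uniq (k :: ks) -> all_down (k :: ks) w ->
  mons w (k :: ks) 0 1 (xi k :: us)
  = (\prod_(q <- k :: ks) (xi k * rho - xi q) * \prod_(u <- us) (u * rho - xi k))
    *: mons (w *m site_op k (delta_mx 1 0)) ks 0 1 us.
Proof.
case/andP => kks Uks /all_downW[wk wD].
rewrite mons_cons row_mon_cons !(down_site (blk _ _ _ _) wk) !blkE /=.
rewrite subrr !scale0r !addr0 mul0mx add0r -scalemxAl.
rewrite (down_mon11 _ Uks (all_down_site _ kks wD)).
rewrite scalerA monsZ (mons01_up _ kks (down_up wk)).
rewrite scalerA big_cons; congr (_ *: _); ring.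
Qed.

Definition raise w ps := foldl (fun w k => w *m site_op k (delta_mx 1 0)) w ps.

Definition lower w ps := foldl (fun w k => w *m site_op k (delta_mx 0 1)) w ps.

(** The factor [xi k * rho - xi q] arises when [k] freezes if [q] is [k] or lies to its right. If
    [q] lies to the left, it is the scalar by which the already flipped site [q] meets the rapidity
    [xi k]. *)
Lemma mons01_freeze_all ps qs w us : uniq (ps ++ qs) -> all_down (ps ++ qs) w ->
  mons w (ps ++ qs) 0 1 (map xi ps ++ us)
  = (\prod_(k <- ps) \prod_(q <- ps ++ qs) (xi k * rho - xi q)
     * \prod_(u <- us) \prod_(k <- ps) (u * rho - xi k))
    *: mons (raise w ps) qs 0 1 us.
Proof.
elim: ps w => [|k ps IH] w.
  by rewrite big_nil big1 ?mulr1 ?scale1r // => u _; rewrite big_nil.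
rewrite map_cons !cat_cons => /[dup] U /andP[kps Ups] wD; rewrite (mons01_freeze _ U wD).
case/all_downW: wD => wk wD.
rewrite (IH _ Ups (all_down_site _ kps wD)).
rewrite scalerA; congr (_ *: _).
rewrite [in RHS]big_cons big_cat big_map /=.
under [X in _ = _ * X * _]eq_bigr => j _ do rewrite big_cons.
under [X in _ = _ * X]eq_bigr => u _ do rewrite big_cons.
rewrite !big_split /=; ring.
Qed.

(** A line entering the down sites [qs] in state 1 cannot end in state 0; it must leave [ps] in
    state 0, and [qs] then contributes an eigenvalue. *)
Lemma mons10_spectator ps qs w vs : uniq qs -> ~~ has (mem qs) ps ->
  all_down qs w ->
  mons w (ps ++ qs) 1 0 vs
  = (\prod_(v <- vs) \prod_(q <- qs) (v - xi q)) *: mons w ps 1 0 vs.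
Proof.
move=> Uqs dis; elim: vs w => [|v vs IH] w wD; first by rewrite big_nil scale1r.
rewrite !mons_cons mon_cat sum_ord2 mulmxDr.
rewrite !(mon_mon_comm _ _ (ks := ps)) 1?has_sym // !mulmxA.
rewrite (down_mon00 _ Uqs wD) (down_mon10 _ Uqs wD) mul0mx addr0 -scalemxAl.
by rewrite monsZ (IH _ (all_down_mon _ _ _ dis wD)) scalerA big_cons.
Qed.

(** Mirror image of the freezing by [B]: on a site in state e_1 the weight [rho * (u - xi k)]
    vanishes, so the site flips to e_2, the line crosses [ps] in state 0, and later operators meet
    only a scalar at [k]. *)
Lemma mons10_freeze k ps w vs : k \notin ps -> all_up (k :: ps) w ->
  mons w (k :: ps) 1 0 (xi k :: vs)
  = ((rho - 1) * xi k * \prod_(q <- ps) (xi k * rho - xi q)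
     * \prod_(v <- vs) (v * rho - xi k))
    *: mons (w *m site_op k (delta_mx 0 1)) ps 1 0 vs.
Proof.
move=> kps /all_upW[wk wU].
rewrite mons_cons row_mon_cons !(up_site (blk _ _ _ _) wk) !blkE /=.
rewrite subrr mulr0 !scale0r !add0r mul0mx addr0 -scalemxAl.
rewrite (up_mon00 _ (all_up_site _ kps wU)) scalerA monsZ.
by rewrite (mons10_down _ kps (up_down wk)) scalerA.
Qed.

Lemma down_intertwiner k l w : k != l -> down k w -> down l w ->
  w *m intertwiner rho xi k l = (xi k * rho - xi l) *: w.
Proof.
move=> kl wk wl; rewrite -{2}wl -{2}wk -{1}wl -{1}wk.
rewrite -!mulmxA scalemxAr; congr (_ *m _); rewrite mulmxA pair_op_site //.
rewrite pair_opM //.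
apply: op2_ext => s t; rewrite [RHS]mxE !pair_opE; case: ifP; rewrite ?mulr0 //.
rewrite !sum_ord2 !mxE; move: (s k) (s l) (t k) (t l) => i j p q _.
elim/ord2_ind: i; elim/ord2_ind: j; elim/ord2_ind: p; elim/ord2_ind: q;
  by rewrite /= ?(mul0r, mulr0, mul1r, mulr1, add0r, addr0).
Qed.

Lemma up_intertwiner k l w : k != l -> up k w -> up l w ->
  w *m intertwiner rho xi k l = (xi k * rho - xi l) *: w.
Proof.
move=> kl wk wl; rewrite -{2}wl -{2}wk -{1}wl -{1}wk.
rewrite -!mulmxA scalemxAr; congr (_ *m _); rewrite mulmxA pair_op_site //.
rewrite pair_opM //.
apply: op2_ext => s t; rewrite [RHS]mxE !pair_opE; case: ifP; rewrite ?mulr0 //.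
rewrite !sum_ord2 !mxE; move: (s k) (s l) (t k) (t l) => i j p q _.
elim/ord2_ind: i; elim/ord2_ind: j; elim/ord2_ind: p; elim/ord2_ind: q;
  by rewrite /= ?(mul0r, mulr0, mul1r, mulr1, add0r, addr0).
Qed.

Lemma intertwiner_ket k l : k != l ->
  intertwiner rho xi k l *m ket1 F L = (xi k * rho - xi l) *: ket1 F L.
Proof.
move=> kl; rewrite -{2}(ket_down F k) -{2}(ket_down F l).
rewrite -{1}(ket_down F k) -{1}(ket_down F l).
rewrite !mulmxA scalemxAl; congr (_ *m _).
rewrite -mulmxA pair_op_site // /intertwiner pair_opM //.
apply: op2_ext => s t; rewrite [RHS]mxE !pair_opE; case: ifP; rewrite ?mulr0 //.
rewrite !sum_ord2 !mxE; move: (s k) (s l) (t k) (t l) => i j p q _.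
elim/ord2_ind: i; elim/ord2_ind: j; elim/ord2_ind: p; elim/ord2_ind: q;
  by rewrite /= ?(mul0r, mulr0, mul1r, mulr1, add0r, addr0).
Qed.

Hypothesis xi_rho_xi : forall j k, j != k -> xi j * rho != xi k.

Lemma mons_ket_perm w us a b c d vs ks ps : perm_eq ks ps -> uniq ks ->
  all_down ks w \/ all_up ks w ->
  (mons (mons w ks a b us) ks c d vs *m ket1 F L) 0 0
  = (mons (mons w ps a b us) ps c d vs *m ket1 F L) 0 0.
Proof.
(* The value 0 outside the permutation class of [ks] makes the swap hypothesis meaningful for all
   lists; inside the class, both swapped sites belong to [ks]. *)
move=> kps Uks wH; pose f qs :=
  if perm_eq ks qs then (mons (mons w qs a b us) qs c d vs *m ket1 F L) 0 0 else 0.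
have : f ks = f ps; last by rewrite /f perm_refl kps.
apply: swap_perm_invariant kps Uks => p k l q.
rewrite /f => U; have sw : perm_eq (p ++ k :: l :: q) (p ++ l :: k :: q).
  by rewrite perm_cat2l (perm_catCA [:: k] [:: l]).
rewrite (permPr sw); case: ifP => // pq.
have kq : k \in ks by rewrite (perm_mem pq) mem_cat !inE eqxx !orbT.
have lq : l \in ks by rewrite (perm_mem pq) mem_cat !inE eqxx !orbT.
move: U; rewrite (perm_uniq (s2 := [:: k, l & p ++ q])); last first.
  by rewrite (perm_catCA p [:: k; l]).
rewrite /= inE negb_or => /and3P[/andP[kl kpq] lpq _].
have wE : w *m intertwiner rho xi k l = (xi k * rho - xi l) *: w.
  by case: wH => H; [apply: down_intertwiner | apply: up_intertwiner] => //; apply: H.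
have n0 : xi k * rho - xi l != 0 by rewrite subr_eq0 xi_rho_xi.
have XC x e g := @mon_exchange F rho L xi k l p q x e g kl kpq lpq.
(* An intertwiner inserted before the right vacuum yields [xi k * rho - xi l]; carried to the left
   through all operators it yields the same factor on [w]. *)
apply: (mulfI n0).
have := congr1 (fun M : 'M_1 => M 0 0)
  (mulmxA (mons (mons w (p ++ [:: k, l & q]) a b us) (p ++ [:: k, l & q]) c d vs)
     (intertwiner rho xi k l) (ket1 F L)).
rewrite intertwiner_ket // -scalemxAr mxE => ->.
rewrite -(mons_exchange _ _ (fun x => XC x c d)).
rewrite -(mons_exchange _ _ (fun x => XC x a b)).
by rewrite wE !monsZ -scalemxAl mxE.
Qed.
End Freezing.

(** * Functions given by polynomials of degree less than n *)

Section PolyFun.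
Variable F : fieldType.
Implicit Types (f g : F -> F) (m n : nat).

Definition is_poly n f := exists2 p : {poly F}, (size p <= n)%N & forall u, f u = p.[u].

Lemma is_poly_ext n f g : (forall u, f u = g u) -> is_poly n f -> is_poly n g.
Proof. by move=> fg [p sp pE]; exists p => // u; rewrite -fg. Qed.

Lemma is_polyW m n f : (m <= n)%N -> is_poly m f -> is_poly n f.
Proof. by move=> mn [p sp pE]; exists p => //; apply: leq_trans mn. Qed.

Lemma is_poly0 n : is_poly n (fun=> 0).
Proof. by exists 0 => [|u]; rewrite ?size_poly0 ?horner0. Qed.

Lemma is_poly_const c n : is_poly n.+1 (fun=> c).
Proof.
exists c%:P => [|u]; rewrite ?hornerC //.
by apply: leq_trans (size_polyC_leq1 _) _.
Qed.

Lemma is_poly_lin a b : is_poly 2 (fun u => a * u + b).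
Proof.
exists (a *: 'X + b%:P) => [|u]; last by rewrite !hornerE.
rewrite (leq_trans (size_polyD _ _)) // geq_max.
rewrite (leq_trans (size_scale_leq _ _)) ?size_polyX //=.
by rewrite (leq_trans (size_polyC_leq1 _)).
Qed.

Lemma is_polyD n f g : is_poly n f -> is_poly n g -> is_poly n (fun u => f u + g u).
Proof.
move=> [p sp pE] [q sq qE]; exists (p + q) => [|u]; last by rewrite hornerD pE qE.
by rewrite (leq_trans (size_polyD _ _)) // geq_max sp.
Qed.

Lemma is_polyM m n f g : is_poly m.+1 f -> is_poly n g ->
  is_poly (m + n) (fun u => f u * g u).
Proof.
move=> [p sp pE] [q sq qE]; exists (p * q) => [|u]; last by rewrite hornerM pE qE.
by rewrite (leq_trans (size_polyMleq _ _)) //; lia.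
Qed.

Lemma is_polyZ n c f : is_poly n f -> is_poly n (fun u => c * f u).
Proof. by apply: (is_polyM (m := 0)); exact: is_poly_const. Qed.

Lemma is_polyZr n c f : is_poly n f -> is_poly n (fun u => f u * c).
Proof. by move/(is_polyZ c); apply: is_poly_ext => u; rewrite mulrC. Qed.

Lemma is_poly_sum (I : Type) (r : seq I) (P : pred I) n (f : I -> F -> F) :
  (forall i, P i -> is_poly n (f i)) -> is_poly n (fun u => \sum_(i <- r | P i) f i u).
Proof.
move=> fP; elim: r => [|i r IH].
  by apply: (is_poly_ext _ (is_poly0 n)) => u; rewrite big_nil.
case Pi: (P i).
  by apply: (is_poly_ext _ (is_polyD (fP i Pi) IH)) => u; rewrite big_cons Pi.
by apply: (is_poly_ext _ IH) => u; rewrite big_cons Pi.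
Qed.

Lemma is_poly_prod (I : Type) (r : seq I) d (f : I -> F -> F) :
  (forall i, is_poly d.+1 (f i)) ->
  is_poly (d * size r).+1 (fun u => \prod_(i <- r) f i u).
Proof.
move=> fP; elim: r => [|i r IH].
  by apply: (is_poly_ext _ (is_poly_const 1 _)) => u; rewrite big_nil.
apply: (is_poly_ext (f := fun u => f i u * \prod_(j <- r) f j u)).
  by move=> u; rewrite big_cons.
by apply: is_polyW (is_polyM (fP i) IH); rewrite /=; lia.
Qed.

Lemma is_poly_unique n f g (s : seq F) :
  is_poly n f -> is_poly n g -> uniq s -> (n <= size s)%N ->
  {in s, f =1 g} -> f =1 g.
Proof.
move=> [p sp pE] [q sq qE] Us ns fg u; rewrite pE qE; apply/eqP.
rewrite -subr_eq0 -hornerN -hornerD (_ : p - q = 0) ?horner0 //.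
apply: (roots_geq_poly_eq0 (rs := s)) => //.
  by apply/allP => x xs; rewrite /root hornerD hornerN -pE -qE fg // subrr.
rewrite (leq_trans _ ns) // (leq_trans (size_polyD _ _)) // size_polyN.
by rewrite geq_max sp.
Qed.

(** Recursion over a list, rather than over pairs of indices, lets one variable be split off from
    the middle, as interpolation in that variable requires. *)
Fixpoint pairprod (h : F -> F -> F) (s : seq F) : F :=
  if s is a :: s' then \prod_(b <- s') h a b * pairprod h s' else 1.

Lemma pairprod_cat_cons h p t q :
  pairprod h (p ++ t :: q)
  = \prod_(a <- p) h a t * \prod_(b <- q) h t b * pairprod h (p ++ q).
Proof.
elim: p => [|a p IH] /=; first by rewrite big_nil mul1r.
by rewrite IH !big_cat !big_cons /=; ring.
Qed.

Lemma pairprod_nth h (s : seq F) : pairprod h s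
  = \prod_(i < size s) \prod_(j < size s | (i < j)%N) h s`_i s`_j.
Proof.
elim: s => [|a s IH] /=; first by rewrite big_ord0.
rewrite big_ord_recl IH; congr (_ * _).
  by rewrite [RHS]big_mkcond big_ord_recl /= mul1r (big_nth 0) big_mkord.
apply: eq_bigr => i _; rewrite [RHS]big_mkcond big_ord_recl /= mul1r.
by rewrite big_mkcond; apply: eq_bigr => j _.
Qed.

Definition delete (T : Type) (j : nat) (s : seq T) := take j s ++ drop j.+1 s.

Lemma nth_delete (x0 : F) j s i : nth x0 (delete j s) i = nth x0 s (bump j i).
Proof.
rewrite /delete nth_cat size_take; case: (ltnP j (size s)) => js; last first.
  rewrite take_oversize // drop_oversize 1?leqW // nth_nil /bump.
  case: ltnP => si.
    by rewrite leqNgt (leq_trans si js).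
  by rewrite nth_default //; lia.
rewrite nth_drop /bump; case: (ltnP i j) => ij.
  by rewrite nth_take.
congr nth; lia.
Qed.

Lemma prod_delete (f : F -> F) j s : (j < size s)%N ->
  \prod_(x <- s) f x = f s`_j * \prod_(x <- delete j s) f x.
Proof.
move=> js; rewrite -{1}(cat_take_drop j s) (drop_nth 0) //.
by rewrite !big_cat big_cons /=; ring.
Qed.

Lemma size_delete (T : Type) j (s : seq T) : (j < size s)%N -> size (delete j s) = (size s).-1.
Proof. by move=> js; rewrite size_cat size_take size_drop js; lia. Qed.
End PolyFun.

(** * Degrees of monodromy entries in the spectral parameter *)

Section MonPoly.
Variables (F : fieldType) (rho : F) (L : nat) (xi : 'I_L -> F).
Notation op := (qop F L).
Notation dim := #|{: {ffun 'I_L -> 'I_2}}|.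
Notation mon := (mon rho xi).
Notation mons := (mons rho xi).
Notation blk := (blk rho).
Implicit Types (ks : seq 'I_L) (w : 'rV[F]_dim) (a b c : 'I_2).

Lemma is_poly_wt d x (a i b j : 'I_2) :
  (1 <= d)%N || ((a == 0) && (b == 1)) -> is_poly d.+1 (fun u => wt rho u x a i b j).
Proof.
elim/ord2_ind: a; elim/ord2_ind: b; elim/ord2_ind: i; elim/ord2_ind: j;
  rewrite /= ?orbF => dd; try exact: is_poly0; try exact: is_poly_const;
  apply: (is_polyW (m := 2)) => //.
- by apply: is_poly_ext (is_poly_lin rho (- x)) => u; rewrite mulrC.
- by apply: is_poly_ext (is_poly_lin 1 (- x)) => u; rewrite mul1r.
- by apply: is_poly_ext (is_poly_lin (rho - 1) 0) => u; rewrite addr0.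
- by apply: is_poly_ext (is_poly_lin rho (- rho * x)) => u; ring.
- by apply: is_poly_ext (is_poly_lin rho (- x)) => u; rewrite mulrC.
Qed.

(** The block from 0 to 1 is constant in [u], the others have degree at most 1, and a path from 0 to
    1 uses that block at least once: [B] has one degree less than the other entries. *)
Lemma is_poly_mon ks a b r s :
  is_poly (size ks + ~~ ((a == 0) && (b == 1))) (fun u => mon ks u a b r s).
Proof.
elim: ks a b r s => [|k ks IH] a b r s /=.
  apply: (is_poly_ext (f := fun=> (if a == b then 1%:M else 0) r s)).
    by move=> u; rewrite mon_nil.
  move: a b; apply: ord2_ind; apply: ord2_ind => /=; try exact: is_poly_const.
    by apply: (is_poly_ext _ (is_poly0 _ _)) => u; rewrite mxE.
have bW c t q : is_poly (1 + ~~ ((a == 0) && (c == 1)))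
    (fun u => site_op k (blk u (xi k) a c) t q).
  apply: (is_poly_ext (f := fun u => if [forall q', (q' != k) ==>
     ((enum_val t : {ffun 'I_L -> 'I_2}) q' == enum_val q q')] then
      wt rho u (xi k) a ((enum_val t : {ffun 'I_L -> 'I_2}) k) c (enum_val q k) else 0)).
    by move=> u; rewrite [RHS]mxE /= !blkE.
  move: [forall q', _] => [|]; last exact: is_poly0.
  by apply: is_poly_wt; case: (_ && _).
apply: (is_poly_ext (f := fun u => \sum_c \sum_t
    site_op k (blk u (xi k) a c) r t * mon ks u c b t s)).
  by move=> u; rewrite mon_cons summxE; apply: eq_bigr => c _; rewrite mxE.
apply: is_poly_sum => c _; apply: is_poly_sum => t _.
apply: is_polyW (is_polyM (bW c r t) (IH c b t s)).
move: {bW IH} a b c; do 3!apply: ord2_ind; rewrite /=; lia.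
Qed.

(** The gauge puts the factor [u] into the flip weight from 1 to 0. This gives domain wall functions
    the interpolation node 0. *)
Lemma mon10_0 ks : mon ks 0 1 0 = 0.
Proof.
elim: ks => [|k ks IH]; first by rewrite mon_nil.
rewrite mon_cons sum_ord2 IH mulmx0 addr0.
rewrite (_ : blk 0 (xi k) 1 0 = 0) ?site_op0 ?mul0mx //.
apply/matrixP; do 2!apply: ord2_ind; by rewrite blkE mxE /= ?mulr0.
Qed.

Lemma monsE w ks a b us :
  mons w ks a b us = w *m foldl (fun X u => X *m mon ks u a b) 1%:M us.
Proof.
have gen X : foldl (fun w u => w *m mon ks u a b) (w *m X) us
    = w *m foldl (fun X u => X *m mon ks u a b) X us.
  by elim: us X => //= u us IH X; rewrite -mulmxA IH.
by rewrite -gen mulmx1.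
Qed.

Lemma is_poly_row_mon w ks a b (X : 'cV[F]_dim) :
  is_poly (size ks + ~~ ((a == 0) && (b == 1)))
    (fun u => (w *m mon ks u a b *m X) 0 0).
Proof.
apply: (is_poly_ext (f := fun u => \sum_j (\sum_i w 0 i * mon ks u a b i j) * X j 0)).
  by move=> u; rewrite mxE; apply: eq_bigr => j _; rewrite mxE.
apply: is_poly_sum => j _; apply: is_polyZr; apply: is_poly_sum => i _.
by apply: is_polyZ; apply: is_poly_mon.
Qed.
End MonPoly.

Lemma prod_subC (F : fieldType) (s : seq F) t :
  \prod_(b <- s) (b - t) = (-1) ^+ size s * \prod_(b <- s) (t - b).
Proof.
elim: s => [|b s IH]; rewrite ?big_nil ?mul1r // !big_cons IH /= exprS; ring.
Qed.

(** * Domain wall partition functions *)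

Section Izergin.
Variables (F : fieldType) (rho : F) (L : nat) (xi : 'I_L -> F).
Notation op := (qop F L).
Notation dim := #|{: {ffun 'I_L -> 'I_2}}|.
Notation mon := (mon rho xi).
Notation mons := (mons rho xi).
Implicit Types (k : 'I_L) (ps : seq 'I_L) (vs xs : seq F) (w : 'rV[F]_dim).

Hypothesis xi_rho_xi : forall j k, j != k -> xi j * rho != xi k.
Hypothesis xi_inj : injective xi.
Hypothesis xi_neq0 : forall k, xi k != 0.

Definition iz (v x : F) := (rho - 1) / ((v - x) * (v * rho - x)).

Definition izmx n vs xs : 'M[F]_n := \matrix_(i, j) iz vs`_i xs`_j.

(** The vector [w] is arbitrary outside [ps], so that removing a site leaves a function of the same
    form; the dependence on [w] ends up in a single overlap with the vacuum. *)
Definition domain_wall w ps vs := (mons w ps 1 0 vs *m ket1 F L) 0 0.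

Lemma lower_front k p q w : k \notin p ->
  lower w (p ++ k :: q) = lower (w *m site_op k (delta_mx 0 1)) (p ++ q).
Proof.
elim: p w => //= l p IH w; rewrite inE negb_or => /andP[kl kp].
by rewrite IH // -!mulmxA site_op_comm // eq_sym.
Qed.

Lemma is_poly_domain_wall w ps vs :
  is_poly (size ps).+1 (fun t => domain_wall w ps (t :: vs)).
Proof.
pose X := foldl (fun X u => X *m mon ps u 1 0) 1%:M vs *m ket1 F L.
apply: (is_poly_ext (f := fun t => (w *m mon ps t 1 0 *m X) 0 0)).
  by move=> t; rewrite /domain_wall mons_cons monsE -[in RHS]mulmxA.
by have := is_poly_row_mon rho xi w ps 1 0 X; rewrite addn1.
Qed.

(* The left-hand side is the polynomial in [t] obtained by clearing the
   denominators in the expansion of a determinant along its first row. *)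
Lemma prod_iz t xs n (c : 'I_n -> F) : size xs = n ->
  (forall x, x \in xs -> t != x /\ t * rho != x) ->
  \sum_(j < n) c j * ((rho - 1) *
      \prod_(x <- delete j xs) ((t - x) * (t * rho - x)))
  = \prod_(x <- xs) ((t - x) * (t * rho - x)) * \sum_(j < n) iz t xs`_j * c j.
Proof.
move=> sx tx; rewrite mulr_sumr; apply: eq_bigr => j _.
have jx : (j < size xs)%N by rewrite sx.
rewrite (prod_delete _ jx) /iz; have [] := tx _ (mem_nth 0 jx).
rewrite -subr_eq0 => t1; rewrite -subr_eq0 => t2.
by field; rewrite t1 t2.
Qed.

(* Both sides are polynomials in the first [v] of degree at most [2 n - 1]; they
   agree at 0, at the other [v], and at the [xi k] (by induction). *)
Lemma izergin n ps vs w : size ps = n -> size vs = n -> uniq ps -> uniq vs ->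
  (forall v, v \in vs -> v != 0 /\ forall k, k \in ps -> v != xi k /\ v * rho != xi k) ->
  all_up ps w ->
  domain_wall w ps vs
    * (pairprod (fun a b => a - b) vs * pairprod (fun a b => b - a) (map xi ps))
  = \prod_(v <- vs) v
    * \prod_(v <- vs) \prod_(x <- map xi ps) ((v - x) * (v * rho - x))
    * \det (izmx n vs (map xi ps)) * (lower w ps *m ket1 F L) 0 0.
Proof.
elim: n ps vs w => [|n IH] ps vs w.
  move=> /size0nil -> /size0nil -> _ _ _ _.
  by rewrite /= !big_nil det_mx00 !mulr1 !mul1r.
case: vs => // v vs sps [svs] Ups /= /andP[vvs Uvs] vH wU.
have vsH t : t \in vs -> t != 0 /\ forall k, k \in ps -> t != xi k /\ t * rho != xi k.
  by move=> tvs; apply: vH; rewrite inE tvs orbT.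
set xs := map xi ps.
have sxs : size xs = n.+1 by rewrite size_map.
have Uxs : uniq xs by rewrite map_inj_uniq.
pose A t := izmx n.+1 (t :: vs) xs.
(* Cofactors of the first row do not see the first rapidity; 0 is a placeholder. Below, [sm] is the
   determinant with its poles in [t] cleared, meaningful also at the nodes [xi k]. *)
pose co j := cofactor (A 0) ord0 j.
have coE t j : cofactor (A t) ord0 j = co j.
  rewrite /co /cofactor; congr (_ * \det _).
  by apply/matrixP => i1 j1; rewrite !mxE.
pose z := (lower w ps *m ket1 F L) 0 0.
pose Wv := \prod_(v <- vs) \prod_(x <- xs) ((v - x) * (v * rho - x)).
pose sm t := \sum_(j < n.+1) co j * ((rho - 1) *
      \prod_(x <- delete j xs) ((t - x) * (t * rho - x))).
have smE t : (forall x, x \in xs -> t != x /\ t * rho != x) ->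
    sm t = \prod_(x <- xs) ((t - x) * (t * rho - x)) * \det (A t).
  move=> tH; rewrite /sm (prod_iz co sxs tH); congr (_ * _).
  rewrite (expand_det_row _ ord0); apply: eq_bigr => j _.
  by rewrite coE [A t _ _]mxE.
pose f t := domain_wall w ps (t :: vs) * ((\prod_(b <- vs) (t - b)
   * pairprod (fun a b => a - b) vs) * pairprod (fun a b => b - a) xs).
pose g t := t * \prod_(v <- vs) v * (Wv * sm t) * z.
suff fg : f =1 g.
  have := fg v; rewrite /f /g smE; last first.
    move=> x /mapP[k kps ->]; apply: (proj2 (vH v _)) => //; exact: mem_head.
  by move=> ->; rewrite !big_cons /Wv -/z; ring.
apply: (@is_poly_unique _ (n.+1 + n.+1) _ _ (0 :: vs ++ xs)).
- apply: (is_poly_ext (f := fun t => (\prod_(b <- vs) (t - b)) *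
    ((pairprod (fun a b => a - b) vs * pairprod (fun a b => b - a) xs)
     * domain_wall w ps (t :: vs)))); first by move=> t; rewrite /f; ring.
  apply: is_polyW (is_polyM (m := 1 * size vs) _ (is_polyZ _ (is_poly_domain_wall w ps vs))).
    by rewrite sps svs; lia.
  apply: is_poly_prod => b; apply: is_poly_ext (is_poly_lin 1 (- b)) => t.
  by rewrite mul1r.
- apply: (is_poly_ext (f := fun t => (1 * t + 0) *
     ((\prod_(v <- vs) v * Wv * z) * sm t))).
    by move=> t; rewrite /g; ring.
  apply: (is_polyW (m := 1 + (2 * n).+1)); first by lia.
  apply: is_polyM; first exact: is_poly_lin.
  apply: is_polyZ; apply: is_poly_sum => j _; apply: is_polyZ; apply: is_polyZ.
  apply: (is_polyW (m := (2 * size (delete j xs)).+1)).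
    by rewrite size_delete sxs //= ltn_ord.
  apply: is_poly_prod => x; apply: (is_polyM (m := 1)).
    by apply: is_poly_ext (is_poly_lin 1 (- x)) => t; rewrite mul1r.
  by apply: is_poly_ext (is_poly_lin rho (- x)) => t; rewrite mulrC.
- rewrite /= mem_cat negb_or cat_uniq Uvs Uxs andbT /=; apply/andP; split.
  + apply/andP; split; first by apply/negP => /vsH[]; rewrite eqxx.
    by apply/mapP => -[k _ /eqP]; rewrite eq_sym (negbTE (xi_neq0 k)).
  + apply/hasPn => x /mapP[k kps ->]; apply/negP => /vsH[_].
    by move=> /(_ k kps)[]; rewrite eqxx.
- by rewrite /= size_cat svs sxs; lia.
move=> t; rewrite inE mem_cat => /or3P[/eqP ->|tvs|txs].
- rewrite /f /g /domain_wall mons_cons mon10_0 mulmx0 mons0 mul0mx mxE.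
  by rewrite !mul0r.
- rewrite /f /g smE; last first.
    by move=> x /mapP[k kps ->]; apply: (proj2 (vsH t tvs)).
  rewrite (_ : \det _ = 0); last first.
    have iv : (index t vs < n)%N by rewrite -svs index_mem.
    apply: (determinant_alternate (i1 := ord0) (i2 := lift ord0 (Ordinal iv))) => //.
    by move=> j; rewrite !mxE /= nth_index.
  rewrite (big_rem t tvs) /= subrr; ring.
have [k kps tE] := mapP txs.
pose j := index k ps; have jps : (j < size ps)%N by rewrite index_mem.
have psE : ps = take j ps ++ k :: drop j.+1 ps.
  by rewrite -{1}(cat_take_drop j ps) (drop_nth k) // nth_index.
pose rs := delete j ps.
have xsE : delete j xs = map xi rs.
  by rewrite /rs /delete map_cat map_take map_drop.
have xj : xs`_j = t by rewrite tE (nth_map k) // nth_index.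
have Uk : k \notin take j ps /\ uniq (k :: rs).
  move: Ups; rewrite {1}psE -(perm_uniq (s1 := k :: rs)); last first.
    by rewrite perm_sym (perm_catCA _ [:: k]) /= perm_refl.
  move=> /[dup] U /andP[]; rewrite mem_cat negb_or => /andP[] //.
have perm_ps : perm_eq ps (k :: rs).
  by rewrite {1}psE (perm_catCA _ [:: k]) /= perm_refl.
case: Uk => kt /= /andP[krs Urs].
have srs : size rs = n by rewrite size_delete // sps.
have jn : (j < n.+1)%N by rewrite -sps.
(* At this node every summand except the one with [j] deleted contains a vanishing factor. *)
have smk : sm t = co (Ordinal jn) * ((rho - 1) *
      \prod_(x <- map xi rs) ((t - x) * (t * rho - x))).
  rewrite /sm (bigD1 (Ordinal jn)) //= xsE [X in _ + X]big1 ?addr0 // => i ij.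
  have ti : t \in delete i xs.
    have : t \in xs`_i :: delete i xs.
      have ix : (i < size xs)%N by rewrite sxs.
      rewrite -(perm_mem (s1 := xs)) //.
      rewrite -{1}(cat_take_drop i xs) (drop_nth 0) //.
      by rewrite (perm_catCA _ [:: _]) /= perm_refl.
    rewrite inE -xj nth_uniq ?sxs ?ltn_ord // => /orP[/eqP E|//].
    by case/eqP: ij; apply: val_inj.
  by rewrite (big_rem t ti) /= subrr !mul0r !mulr0.
have coj : co (Ordinal jn) = (-1) ^+ j * \det (izmx n vs (map xi rs)).
  rewrite /co /cofactor add0n; congr (_ * \det _).
  apply/matrixP => i1 j1; rewrite !mxE /=; congr iz.
  by rewrite -xsE nth_delete.
have fE : domain_wall w ps (t :: vs)
   = ((rho - 1) * t * \prod_(x <- map xi rs) (t * rho - x)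
      * \prod_(v <- vs) (v * rho - t))
     * domain_wall (w *m site_op k (delta_mx 0 1)) rs vs.
  have wUk : all_up (k :: rs) w by move=> l; rewrite -(perm_mem perm_ps); apply: wU.
  have E : domain_wall w ps (t :: vs) = domain_wall w (k :: rs) (t :: vs).
    exact: (mons_ket_perm xi_rho_xi [::] 0 0 1 0 (t :: vs) perm_ps Ups (or_intror wU)).
  rewrite E /domain_wall tE (mons10_freeze rho xi vs krs wUk) -scalemxAl mxE.
  by rewrite big_map.
have wU' : all_up rs (w *m site_op k (delta_mx 0 1)).
  apply: all_up_site => // l lrs; apply: wU.
  by rewrite (perm_mem perm_ps) inE lrs orbT.
have vsH' v' : v' \in vs -> v' != 0 /\
    forall l, l \in rs -> v' != xi l /\ v' * rho != xi l.
  move=> vvs'; have [v0 vx] := vsH v' vvs'; split => // l lrs; apply: vx.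
  by rewrite (perm_mem perm_ps) inE lrs orbT.
have := IH rs vs _ srs svs Urs Uvs vsH' wU'.
have -> : lower (w *m site_op k (delta_mx 0 1)) rs = lower w ps.
  by rewrite [in RHS]psE lower_front.
rewrite -/z => IHE.
have ppE : pairprod (fun a b => b - a) xs = (-1) ^+ size (drop j.+1 ps)
    * \prod_(x <- map xi rs) (t - x) * pairprod (fun a b => b - a) (map xi rs).
  rewrite /xs {1}psE map_cat map_cons pairprod_cat_cons -tE.
  rewrite /rs /delete map_cat big_cat /= prod_subC size_map; ring.
have WvE : Wv = \prod_(v <- vs) ((v - t) * (v * rho - t)) *
   \prod_(v <- vs) \prod_(x <- map xi rs) ((v - x) * (v * rho - x)).
  rewrite -big_split; apply: eq_bigr => v' _.
  by rewrite (prod_delete _ (j := j)) ?sxs // xj xsE.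
(* Three signs cancel by this sum: [(-1) ^+ j] from the cofactor, [(-1) ^+ size (drop j.+1 ps)] from
   the pair product over [xs], and [(-1) ^+ n] from turning each [v - t] into [t - v]. *)
have nE : n = (j + size (drop j.+1 ps))%N.
  by have := jn; rewrite size_drop sps; lia.
rewrite /f /g fE ppE smk coj WvE !big_split /= [\prod_(v' <- vs) (v' - t)]prod_subC svs.
have s2 m : (-1) ^+ m * (-1) ^+ m = 1 :> F by rewrite -exprMn mulrNN mul1r expr1n.
rewrite {1}nE exprD.
pose K := (rho - 1) * t * \prod_(x <- [seq xi i | i <- rs]) (t * rho - x)
  * \prod_(v0 <- vs) (v0 * rho - t) * \prod_(b <- vs) (t - b)
  * (-1) ^+ size (drop j.+1 ps) * \prod_(x <- [seq xi i | i <- rs]) (t - x).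
move/(congr1 ( *%R K)): IHE => IHE.
transitivity ((-1) ^+ j * (-1) ^+ j * (K * (\prod_(v <- vs) v *
   \prod_(v <- vs) \prod_(x <- map xi rs) ((v - x) * (v * rho - x)) *
   \det (izmx n vs (map xi rs)) * z))).
  by rewrite s2 mul1r -IHE /K; ring.
by rewrite /K; ring.
Qed.
End Izergin.

Lemma is_poly_div (F : fieldType) n (f : F -> F) a : is_poly n.+1 f -> f a = 0 ->
  exists h, is_poly n h /\ forall u, (a - u) * h u = f u.
Proof.
case=> p sp pE fa; have /factor_theorem[q qE] : root p a by rewrite /root -pE fa.
exists (fun u => - q.[u]); split; last first.
  by move=> u; rewrite pE qE !hornerE; ring.
exists (- q) => [|u]; last by rewrite hornerN.
rewrite size_polyN; case: (eqVneq q 0) => [->|q0]; first by rewrite size_poly0.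
by move: sp; rewrite qE size_Mmonic ?monicXsubC // size_XsubC addn2.
Qed.

Lemma det_row_scale (F : fieldType) n (r : 'I_n -> F) (A : 'M[F]_n) :
  \det (\matrix_(i, j) (r i * A i j)) = \prod_i r i * \det A.
Proof.
rewrite (_ : \matrix_(i, j) _ = diag_mx (\row_i r i) *m A).
  by rewrite det_mulmx det_diag; congr (_ * _); apply: eq_bigr => i _; rewrite mxE.
by apply/matrixP => i j; rewrite mul_diag_mx !mxE.
Qed.

(** * The scalar product formula in the polynomial gauge *)

Section Core.
Variables (F : fieldType) (rho : F) (L : nat) (xi : 'I_L -> F).
Notation op := (qop F L).
Notation dim := #|{: {ffun 'I_L -> 'I_2}}|.
Notation mon := (mon rho xi).
Notation mons := (mons rho xi).
Notation correl := (correl rho xi).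
Implicit Types (k : 'I_L) (ps ks qs : seq 'I_L) (us xs : seq F) (w : 'rV[F]_dim).

Hypothesis rho_neq0 : rho != 0.
Hypothesis rho_neq1 : rho != 1.
Hypothesis xi_rho_xi : forall j k, j != k -> xi j * rho != xi k.
Hypothesis xi_inj : injective xi.
Hypothesis xi_neq0 : forall k, xi k != 0.

Variables (M : nat) (V : 'I_M -> F) (kappa : F).
Hypothesis V_inj : injective V.
Hypothesis V_neq0 : forall i, V i != 0.
Hypothesis V_xi : forall i k, V i != xi k.
Hypothesis V_rho_xi : forall i k, V i * rho != xi k.
Hypothesis kappa_neq0 : kappa != 0.

Notation vs := (map V (enum 'I_M)).

Hypothesis bethe : forall i,
  kappa * \prod_(m < M | m != i) (V m * rho - V i)
  = \prod_(k < L) ((V i - xi k) / (V i * rho - xi k))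
    * \prod_(m < M | m != i) (V m - V i * rho).

Lemma nth_vs (i : 'I_M) : vs`_i = V i.
Proof. by rewrite (nth_map i) ?size_enum_ord // nth_ord_enum. Qed.

(* When [V m = V i * rho] occurs, the Bethe equations may be void (0 = 0) and do
   not determine [kappa ^+ M].  They then force the set of such [i] to be stable
   under multiplication by [rho], and the rows weighted by [V i] telescope along
   this permutation. *)
Lemma izmx_string_eq0 xs : (forall i x, x \in xs -> V i != x /\ V i * rho != x) ->
  size xs = M -> (exists i m, V m = V i * rho) -> \det (izmx rho M vs xs) = 0.
Proof.
move=> Vx sx [i0 [m0 im0]]; apply/eqP/det0P.
pose D := [pred i | [exists m, V m == V i * rho]].
have succ_neq i m : V m = V i * rho -> m != i.
  move=> E; apply: contraNneq rho_neq1 => mi; rewrite mi in E.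
  by apply/eqP/(mulfI (V_neq0 i)); rewrite mulr1 -E.
have predD i m : V m = V i * rho -> m \in D.
  move=> E; have := bethe m; rewrite (bigD1 i) /=; last first.
    by rewrite eq_sym; apply: succ_neq.
  rewrite -E subrr mul0r mulr0 => /esym/eqP; rewrite mulf_eq0; case/orP.
    case/prodf_eq0 => k _; rewrite mulf_eq0 invr_eq0 !subr_eq0.
    by rewrite (negbTE (V_xi _ _)) (negbTE (V_rho_xi _ _)).
  case/prodf_eq0 => j _; rewrite subr_eq0 => Ej.
  by apply/existsP; exists j.
pose s i := if i \in D then odflt i [pick m | V m == V i * rho] else i.
have sD i : i \in D -> V (s i) = V i * rho.
  move=> iD; rewrite /s iD; case: pickP => [m /eqP //|no].
  by case/existsP: iD => m; rewrite no.
have s_D i : (s i \in D) = (i \in D).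
  case iD: (i \in D); last by rewrite /s iD iD.
  by apply: (predD i); apply: sD.
have s_inj : injective s.
  move=> i j sij; have := s_D i; rewrite sij s_D => ijD.
  case iD: (i \in D); last first.
    by move: sij; rewrite /s iD ijD iD.
  apply: V_inj; apply: (mulIf rho_neq0).
  by rewrite -!sD ?sij // ijD.
exists (\row_i (if i \in D then V i else 0)).
  apply/eqP => /matrixP/(_ 0 i0); rewrite !mxE ifT.
    by move/eqP; rewrite (negbTE (V_neq0 _)).
  by apply/existsP; exists m0; rewrite im0.
apply/rowP => j; rewrite !mxE.
set x := xs`_j; have xxs : x \in xs by rewrite mem_nth // sx.
rewrite (eq_bigr (fun i => if i \in D then (V i - x)^-1 - (V (s i) - x)^-1 else 0));
  last first.
  move=> i _; rewrite !mxE nth_vs; case: ifP => iD; last by rewrite mul0r.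
  have [] := Vx i _ xxs; rewrite -subr_eq0 => t1; rewrite -subr_eq0 => t2.
  by rewrite sD // /iz -/x; field; rewrite t1 t2.
rewrite -big_mkcond sumrB [X in X - _](reindex_inj s_inj) /=.
rewrite (eq_bigl (mem D)) ?subrr // => i; exact: s_D.
Qed.

(** Product of all Bethe equations. The two double products over [m != i] agree, since exchanging
    the indices costs M (M - 1) signs, an even number; they can be divided out unless some
    [V m = V i * rho], when the determinant is 0. *)
Lemma det_izmx_kappa xs : (forall i x, x \in xs -> V i != x /\ V i * rho != x) ->
  size xs = M ->
  kappa ^+ M * \prod_(i < M) \prod_(k < L) (V i * rho - xi k) * \det (izmx rho M vs xs)
  = \prod_(i < M) \prod_(k < L) (V i - xi k) * \det (izmx rho M vs xs).
Proof.
move=> Vx sx.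
case: (boolP [exists i, exists m, V m == V i * rho]) => [|no].
  case/existsP => i /existsP[m /eqP E].
  by rewrite (izmx_string_eq0 Vx sx) ?mulr0 //; exists i, m.
have nz i m : V m - V i * rho != 0.
  rewrite subr_eq0; apply: contra no => E.
  by apply/existsP; exists i; apply/existsP; exists m.
congr (_ * _).
have : \prod_(i < M) (kappa * \prod_(m < M | m != i) (V m * rho - V i))
    = \prod_(i < M) (\prod_(k < L) ((V i - xi k) / (V i * rho - xi k))
       * \prod_(m < M | m != i) (V m - V i * rho)).
  by apply: eq_bigr => i _; apply: bethe.
rewrite !big_split /= prodr_const card_ord.
pose Q := \prod_(i < M) \prod_(m < M | m != i) (V m - V i * rho).
have QE : \prod_(i < M) \prod_(m < M | m != i) (V m * rho - V i) = Q.
  rewrite (exchange_big_dep xpredT) //=.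
  transitivity (\prod_(i < M) ((-1) ^+ M.-1 * \prod_(m < M | m != i) (V m - V i * rho))).
    apply: eq_bigr => i _; rewrite -[in (-1) ^+ _](card_ord M) -(cardC1 i) -prodr_const.
    rewrite -big_split; apply: eq_big => m; first by rewrite eq_sym.
    by move=> _ /=; ring.
  rewrite big_split /= prodr_const card_ord -exprM -signr_odd oddM.
  by rewrite (_ : odd M.-1 && odd M = false) ?mul1r //; case: (M) => //= n; case: odd.
rewrite QE -/Q.
have Q0 : Q != 0.
  by apply/prodf_neq0 => i _; apply/prodf_neq0 => m _; apply: nz.
move/(mulIf Q0) => ->; rewrite -big_split; apply: eq_bigr => i _ /=.
rewrite -big_split; apply: eq_bigr => k _ /=.
by rewrite divfK // subr_eq0.
Qed.

(** The braces of the matrix entry in the theorem at rapidity [u], with the denominators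
    [u * rho - xi k] cleared. *)
Definition bracket (i : 'I_M) (u : F) :=
  kappa * \prod_(m < M | m != i) (V m * rho - u) * \prod_(k < L) (u * rho - xi k)
  - \prod_(k < L) (u - xi k) * \prod_(m < M | m != i) (V m - u * rho).

Lemma is_poly_prod_ord (n d : nat) (f : 'I_n -> F -> F) :
  (forall i, is_poly d.+1 (f i)) -> is_poly (d * n).+1 (fun u => \prod_(i < n) f i u).
Proof.
move=> /(is_poly_prod (enum 'I_n)); rewrite size_enum_ord.
by apply: is_poly_ext => u; rewrite big_enum.
Qed.

Lemma is_poly_prod_neq (n : nat) (i : 'I_n) (f : 'I_n -> F -> F) :
  (forall i, is_poly 2 (f i)) ->
  is_poly n (fun u => \prod_(m < n | m != i) f m u).
Proof.
move=> /(is_poly_prod (enum (predC1 i))); rewrite -cardE cardC1 card_ord mul1n.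
rewrite prednK ?(leq_ltn_trans _ (ltn_ord i)) //.
by apply: is_poly_ext => u; rewrite big_enum.
Qed.

Lemma is_poly_bracket i : is_poly (L + M) (bracket i).
Proof.
have p1 a b : is_poly 2 (fun u : F => a - u * b).
  by apply: is_poly_ext (is_poly_lin (- b) a) => u; ring.
have p2 a b : is_poly 2 (fun u : F => u * b - a).
  by apply: is_poly_ext (is_poly_lin b (- a)) => u; ring.
apply: (is_poly_ext (f := fun u => \prod_(k < L) (u * rho - xi k) *
   (kappa * \prod_(m < M | m != i) (V m * rho - u * 1)) +
   -1 * (\prod_(k < L) (u * 1 - xi k) * \prod_(m < M | m != i) (V m - u * rho)))).
  move=> u; rewrite /bracket !mulr1; ring.
apply: is_polyD; last apply: is_polyZ; apply: is_polyM;
  rewrite -1?[in is_poly L.+1]mul1n; try apply: is_polyZ.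
- have := @is_poly_prod_ord L 1 (fun k u => u * rho - xi k) (fun k => p2 _ _).
  by rewrite mul1n.
- by apply: is_poly_prod_neq.
- have := @is_poly_prod_ord L 1 (fun k u => u * 1 - xi k) (fun k => p2 _ _).
  by rewrite mul1n.
- by apply: is_poly_prod_neq.
Qed.

Lemma bracket_root i : bracket i (V i) = 0.
Proof.
rewrite /bracket bethe prodf_div; apply/eqP; rewrite subr_eq0; apply/eqP.
have nz : \prod_(k < L) (V i * rho - xi k) != 0.
  by apply/prodf_neq0 => k _; rewrite subr_eq0.
by field.
Qed.

(** * All rapidities at inhomogeneities *)

Lemma correl_perm us ts ks ps : perm_eq ks ps -> uniq ks ->
  correl (ket1 F L)^T ks us ts = correl (ket1 F L)^T ps us ts.
Proof.
move=> kps Uks; apply: (mons_ket_perm xi_rho_xi us 0 1 1 0 ts kps Uks).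
by left => k _; apply: bra_down.
Qed.

Lemma raise_comm w (X : op) ps :
  (forall k A, k \in ps -> X *m site_op k A = site_op k A *m X) ->
  raise (w *m X) ps = raise w ps *m X.
Proof.
elim: ps w => //= k ps IH w XC; rewrite -IH.
  by rewrite -!mulmxA XC ?mem_head.
by move=> l A lps; apply: XC; rewrite inE lps orbT.
Qed.

Lemma raise_site k A w ps : k \notin ps ->
  raise (w *m site_op k A) ps = raise w ps *m site_op k A.
Proof.
move=> kps; apply: raise_comm => l B lps; apply: site_op_comm.
by apply: contraNneq kps => ->.
Qed.

Lemma raise_up ps w : uniq ps -> all_down ps w -> all_up ps (raise w ps).
Proof.
elim: ps w => // k ps IH w /andP[kps Ups] /all_downW[wk wD] l /=.
rewrite inE => /orP[/eqP ->|lps]; last first.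
  by apply: IH => //; apply: all_down_site.
rewrite raise_site //; apply: down_up.
by rewrite /down -raise_site // wk.
Qed.

Lemma raise_down ps qs w : ~~ has (mem qs) ps -> all_down qs w ->
  all_down qs (raise w ps).
Proof.
elim: ps w => //= k ps IH w; rewrite negb_or => /andP[kqs H] wD.
by apply: IH => //; apply: all_down_site.
Qed.

Lemma lower_raise ps w : uniq ps -> all_down ps w -> lower (raise w ps) ps = w.
Proof.
elim: ps w => // k ps IH w /andP[kps Ups] /all_downW[wk wD] /=.
rewrite raise_site // -mulmxA -site_opM mul_delta_mx -raise_site // wk.
exact: IH.
Qed.

Lemma bra_ket : ((ket1 F L)^T *m ket1 F L) 0 0 = 1.
Proof.
rewrite mulmx_conf (bigD1 [ffun=> 1]) //= big1 ?addr0.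
  by rewrite !mxE enum_rankK eqxx mulr1.
by move=> s /negbTE s1; rewrite !mxE enum_rankK s1 mul0r.
Qed.

Lemma prod_vs (f : F -> F) : \prod_(v <- vs) f v = \prod_(i < M) f (V i).
Proof. by rewrite big_map big_enum. Qed.

(** The [B] operators flip exactly [ps]; the other sites stay down and contribute scalars to the [C]
    operators, which leaves a domain wall function on [ps]. Lowering undoes raising, so its overlap
    factor is 1. *)
Lemma correl_frozen ps : uniq ps -> size ps = M ->
  correl (ket1 F L)^T (enum 'I_L) (map xi ps) vs
    * (pairprod (fun a b => b - a) (map xi ps) * pairprod (fun a b => a - b) vs)
  = \prod_(k <- ps) \prod_(q < L) (xi k * rho - xi q)
    * \prod_(i < M) V i
    * \prod_(i < M) \prod_(k < L) (V i - xi k)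
    * \prod_(i < M) \prod_(k <- ps) (V i * rho - xi k)
    * \det (izmx rho M vs (map xi ps)).
Proof.
move=> Ups sps; pose qs := filter [predC ps] (enum 'I_L).
have Uqs : uniq qs by rewrite filter_uniq // enum_uniq.
have dis : ~~ has (mem qs) ps.
  by apply/hasPn => k kps; rewrite !inE mem_filter /= kps.
have Upq : uniq (ps ++ qs).
  by rewrite cat_uniq Ups Uqs has_sym dis.
have perm_pq : perm_eq (enum 'I_L) (ps ++ qs).
  apply: uniq_perm; rewrite ?enum_uniq // => k.
  by rewrite mem_cat [k \in qs]mem_filter mem_enum /= andbT; case: (k \in ps).
have big_pq (f : 'I_L -> F) : \prod_(q < L) f q = \prod_(q <- ps ++ qs) f q.
  by rewrite -(perm_big _ perm_pq) big_enum.
rewrite (correl_perm _ _ perm_pq (enum_uniq _)).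
have bD ks : all_down ks (ket1 F L)^T by move=> k _; apply: bra_down.
have fz := mons01_freeze_all rho xi [::] Upq (bD _); rewrite cats0 in fz.
rewrite /correl fz big_nil mulr1 monsZ -scalemxAl mxE.
rewrite (mons10_spectator rho xi vs Uqs dis (raise_down dis (bD _))).
rewrite -scalemxAl mxE -/(domain_wall rho xi _ ps vs).
have Vvs v : v \in vs -> v != 0 /\ forall k, k \in ps -> v != xi k /\ v * rho != xi k.
  by case/mapP => i _ ->; split => // k _; split.
have svs : size vs = M by rewrite size_map size_enum_ord.
have Uvs : uniq vs by rewrite map_inj_uniq // enum_uniq.
have := izergin xi_rho_xi xi_inj xi_neq0 sps svs Ups Uvs Vvs (raise_up Ups (bD _)).
rewrite lower_raise // bra_ket mulr1 !prod_vs => iz_eq.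
transitivity (\prod_(k <- ps) \prod_(q <- ps ++ qs) (xi k * rho - xi q)
  * \prod_(i < M) \prod_(q <- qs) (V i - xi q)
  * (domain_wall rho xi (raise (ket1 F L)^T ps) ps vs
     * (pairprod (fun a b => a - b) vs * pairprod (fun a b => b - a) (map xi ps)))).
  by ring.
rewrite iz_eq.
under [X in X * _ * _ = _]eq_bigr => k _ do rewrite -big_pq.
under [X in _ = _ * X * _ * _]eq_bigr => i _ do rewrite big_pq big_cat.
under [X in _ * (_ * X * _) = _]eq_bigr => i _ do rewrite big_map big_split.
rewrite !big_split /=; ring.
Qed.

Lemma core_frozen (h : 'I_M -> F -> F) ps :
  (forall i u, (V i - u) * h i u = (rho - 1) * bracket i u) ->
  uniq ps -> size ps = M ->
  correl (ket1 F L)^T (enum 'I_L) (map xi ps) vs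
    * (pairprod (fun a b => b - a) (map xi ps) * pairprod (fun a b => a - b) vs)
  = \prod_(i < M) V i * \prod_(i < M) \prod_(k < L) (V i * rho - xi k)
    * \det (\matrix_(j < M, i < M) h i (map xi ps)`_j).
Proof.
move=> hE Ups sps; rewrite correl_frozen //.
set xs := map xi ps; have sxs : size xs = M by rewrite size_map.
have xsV i x : x \in xs -> V i != x /\ V i * rho != x.
  by case/mapP => k _ ->.
(* At an inhomogeneity the second term of [bracket] vanishes, and the row is [r j] times a row of
   the transposed Izergin matrix. The resulting [kappa ^+ M] is traded away by [det_izmx_kappa]. *)
pose r (j : 'I_M) := kappa * \prod_(m < M) (V m * rho - xs`_j)
   * \prod_(k < L) (xs`_j * rho - xi k).
have -> : (\matrix_(j < M, i < M) h i xs`_j)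
    = \matrix_(j < M, i < M) (r j * (izmx rho M vs xs)^T j i).
  apply/matrixP => j i; rewrite !mxE nth_vs /r.
  have jx : xs`_j \in xs by rewrite mem_nth // sxs.
  have [] := xsV i _ jx; rewrite -subr_eq0 => t1; rewrite -subr_eq0 => t2.
  apply: (mulfI t1); rewrite hE /bracket.
  rewrite [X in _ - X * _](_ : _ = 0); last first.
    case/mapP: jx => k _ ->; apply/eqP/prodf_eq0; exists k => //.
    by rewrite subrr.
  rewrite mul0r subr0 [in RHS](bigD1 i) //= /iz.
  by field; rewrite t1 t2.
rewrite det_row_scale det_tr /r big_split /= big_split /= prodr_const card_ord.
have := det_izmx_kappa xsV sxs => kap.
have -> : \prod_(j < M) \prod_(m < M) (V m * rho - xs`_j)
    = \prod_(i < M) \prod_(k <- ps) (V i * rho - xi k).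
  rewrite exchange_big; apply: eq_bigr => i _ /=.
  by rewrite -(big_map xi xpredT (fun x => V i * rho - x)) (big_nth 0) sxs big_mkord.
have -> : \prod_(j < M) \prod_(k < L) (xs`_j * rho - xi k)
    = \prod_(k <- ps) \prod_(q < L) (xi k * rho - xi q).
  rewrite -(big_map xi xpredT (fun x => \prod_(q < L) (x * rho - xi q))).
  by rewrite (big_nth 0) sxs big_mkord.
transitivity (\prod_(k <- ps) \prod_(q < L) (xi k * rho - xi q)
    * \prod_(i < M) V i * \prod_(i < M) \prod_(k <- ps) (V i * rho - xi k)
    * (\prod_(i < M) \prod_(k < L) (V i - xi k) * \det (izmx rho M vs xs))).
  by ring.
by rewrite -kap; ring.
Qed.

(** * Interpolation in a free rapidity *)

Lemma is_poly_correl w ks pre us ts :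
  is_poly (size ks) (fun t => correl w ks (pre ++ t :: us) ts).
Proof.
pose X := foldl (fun X u => X *m mon ks u 0 1) 1%:M us *m
  (foldl (fun X u => X *m mon ks u 1 0) 1%:M ts *m ket1 F L).
apply: (is_poly_ext (f := fun t => (mons w ks 0 1 pre *m mon ks t 0 1 *m X) 0 0)).
  move=> t; have E : mons w ks 0 1 (pre ++ t :: us)
      = mons (mons w ks 0 1 pre *m mon ks t 0 1) ks 0 1 us by rewrite mons_cat.
  rewrite /correl E [mons _ ks 0 1 us]monsE [mons _ ks 1 0 ts]monsE.
  by rewrite /X !mulmxA.
by have := is_poly_row_mon rho xi (mons w ks 0 1 pre) ks 0 1 X; rewrite addn0.
Qed.

(** Once frozen, the site [k] multiplies each later [B] by [u * rho - xi k]. *)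
Lemma correl_string_eq0 ps us ts k u : uniq ps -> k \in ps -> u * rho = xi k ->
  correl (ket1 F L)^T (enum 'I_L) (map xi ps ++ u :: us) ts = 0.
Proof.
move=> Ups kps uk; pose qs := filter [predC ps] (enum 'I_L).
have Uqs : uniq qs by rewrite filter_uniq // enum_uniq.
have Upq : uniq (ps ++ qs).
  rewrite cat_uniq Ups Uqs andbT; apply/hasPn => q.
  by rewrite mem_filter /= => /andP[].
have perm_pq : perm_eq (enum 'I_L) (ps ++ qs).
  apply: uniq_perm; rewrite ?enum_uniq // => q.
  by rewrite mem_cat [q \in qs]mem_filter mem_enum /= andbT; case: (q \in ps).
rewrite (correl_perm _ _ perm_pq (enum_uniq _)) /correl.
rewrite mons01_freeze_all //; last by move=> q _; apply: bra_down.
rewrite [\prod_(u <- u :: us) _](_ : _ = 0) ?mulr0 ?scale0r ?mons0 ?mul0mx ?mxE //.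
by rewrite big_cons (big_rem k kps) /= uk subrr !mul0r.
Qed.

(* [h i u] is [(rho - 1) / (V i - u) * bracket i u], a polynomial in [u] because
   the Bethe equations make the bracket vanish at [u = V i]. *)
Variable h : 'I_M -> F -> F.
Hypothesis h_poly : forall i, is_poly (L + M).-1 (h i).
Hypothesis hE : forall i u, (V i - u) * h i u = (rho - 1) * bracket i u.

(** Rows belong to rapidities and columns to Bethe roots, the transpose of the arrangement in the
    theorem: one free rapidity occupies one row. *)
Definition slavnov_mx us : 'M[F]_M := \matrix_(j, i) h i us`_j.

(* Both rows are multiples of [1 / ((V i - xi k) * (V i * rho - xi k))]. *)
Lemma slavnov_mx_eq0 us (k : 'I_L) (j j' : 'I_M) u : j != j' ->
  us`_j = xi k -> us`_j' = u -> u * rho = xi k -> \det (slavnov_mx us) = 0.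
Proof.
move=> jj' usj usj' uk; apply/eqP/det0P.
pose q (i : 'I_M) := ((V i - xi k) * (V i * rho - xi k))^-1.
have n1 i : V i - xi k != 0 by rewrite subr_eq0.
have n2 i : V i * rho - xi k != 0 by rewrite subr_eq0.
have r1 : rho - 1 != 0 by rewrite subr_eq0.
pose c1 := (rho - 1) * kappa * \prod_(m < M) (V m * rho - xi k)
  * \prod_(l < L) (xi k * rho - xi l).
pose c2 := - (rho - 1) * rho * \prod_(m < M) (V m - xi k)
  * \prod_(l < L) (u - xi l).
have h1 i : h i (xi k) = c1 * q i.
  apply: (mulfI (n1 i)); rewrite hE /bracket.
  rewrite [X in _ - X * _](_ : _ = 0); last first.
    by apply/eqP/prodf_eq0; exists k => //; rewrite subrr.
  rewrite mul0r subr0 /c1 [in RHS](bigD1 i) //= /q.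
  by field; rewrite n1 n2.
have h2 i : h i u = c2 * q i.
  have uE : V i - u = (V i * rho - xi k) / rho by rewrite -uk; field.
  have n3 : V i - u != 0 by rewrite uE mulf_neq0 ?invr_eq0.
  apply: (mulfI n3); rewrite hE /bracket.
  rewrite [X in _ * X - _](_ : _ = 0); last first.
    by apply/eqP/prodf_eq0; exists k => //; rewrite uk subrr.
  rewrite mulr0 sub0r uE uk /c2 [in RHS](bigD1 i) //= /q.
  by field; rewrite n1 n2 rho_neq0.
have c1_neq0 : c1 != 0.
  rewrite /c1 !mulf_neq0 //; apply/prodf_neq0 => l _ //.
  rewrite subr_eq0; case: (eqVneq k l) => [<-|/xi_rho_xi //].
  by rewrite -{2}[xi k]mulr1 (inj_eq (mulfI (xi_neq0 k))).
exists (c2 *: delta_mx 0 j - c1 *: delta_mx 0 j').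
  apply/eqP => /matrixP/(_ 0 j'); rewrite !mxE !eqxx [j' == j]eq_sym (negbTE jj').
  by move/eqP; rewrite mulr0 sub0r mulr1 oppr_eq0 (negbTE c1_neq0).
rewrite mulmxBl -!scalemxAl -!rowE; apply/rowP => i; rewrite !mxE usj usj' h1 h2.
by ring.
Qed.

(* Induction on the number of rapidities not frozen at inhomogeneities.  Both
   sides are polynomials of degree less than [L + M - 1] in the first free one;
   they vanish at the other rapidities and at [xi k / rho] for the frozen sites
   [k], and agree at the remaining [xi k] by induction. *)
Lemma scalar_product_core us ps :
  uniq us -> (forall u, u \in us -> forall k, u != xi k /\ u * rho != xi k) ->
  uniq ps -> (size ps + size us)%N = M ->
  correl (ket1 F L)^T (enum 'I_L) (map xi ps ++ us) vs
    * (pairprod (fun a b => b - a) (map xi ps ++ us) * pairprod (fun a b => a - b) vs)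
  = \prod_(i < M) V i * \prod_(i < M) \prod_(k < L) (V i * rho - xi k)
    * \det (slavnov_mx (map xi ps ++ us)).
Proof.
elim: us ps => [|u us IH] ps Uus usx Ups spu.
  rewrite cats0; apply: core_frozen => //.
  by rewrite -spu addn0.
have Uus' : uniq us by case/andP: Uus.
have usx' u' : u' \in us -> forall k, u' != xi k /\ u' * rho != xi k.
  by move=> uu; apply: usx; rewrite inE uu orbT.
set pre := map xi ps in spu *; have spre : size pre = size ps by rewrite size_map.
pose P := pairprod (fun a b : F => b - a) (pre ++ us).
pose W := pairprod (fun a b : F => a - b) vs.
pose f t := correl (ket1 F L)^T (enum 'I_L) (pre ++ t :: us) vs
   * (\prod_(a <- pre) (t - a) * \prod_(b <- us) (b - t) * P * W).
pose K := \prod_(i < M) V i * \prod_(i < M) \prod_(k < L) (V i * rho - xi k).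
pose g t := K * \det (slavnov_mx (pre ++ t :: us)).
suff fg : f =1 g.
  by have := fg u; rewrite /f /g /P -(pairprod_cat_cons (fun a b : F => b - a)).
have jM : (size pre < M)%N by rewrite spre -spu /=; lia.
pose j := Ordinal jM.
pose qs := filter [predC ps] (enum 'I_L).
have Uqs : uniq qs by rewrite filter_uniq // enum_uniq.
have sqs : (size ps + size qs)%N = L.
  rewrite -[RHS]size_enum_ord -(count_predC [in ps] (enum 'I_L)) /qs size_filter; congr (_ + _)%N.
  rewrite -size_filter; apply: perm_size; apply: uniq_perm => //.
    by rewrite filter_uniq // enum_uniq.
  by move=> k; rewrite mem_filter mem_enum /= andbT.
have sus : (size ps + size us).+1 = M by rewrite -spu /=; lia.
have nth_eq t i : i != size pre -> (pre ++ t :: us)`_i = (pre ++ 0 :: us)`_i.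
  move=> ip; rewrite !nth_cat; case: ltnP => // pi; case E: (i - size pre)%N => //.
  by case/negP: ip; rewrite eqn_leq pi andbT -subn_eq0 E.
have node_eq0 t : t \in pre ++ us -> f t = g t.
  move=> tpu; rewrite /f /g.
  have -> : \det (slavnov_mx (pre ++ t :: us)) = 0.
    have [i [iM ip it]] : exists i, [/\ (i < M)%N, i != size pre & (pre ++ t :: us)`_i = t].
      move: tpu; rewrite mem_cat => /orP[tp|tu].
        exists (index t pre); move: (tp); rewrite -index_mem => ti.
        by split; rewrite ?(ltn_trans ti jM) ?neq_ltn ?ti // nth_cat ti nth_index.
      exists (size pre + (index t us).+1)%N; move: (tu); rewrite -index_mem => ti.
      split; [by rewrite spre -sus ltnS leq_add2l | by rewrite neq_ltn addnS ltnS leq_addr orbT |].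
      rewrite nth_cat ifN; last by rewrite -leqNgt leq_addr.
      by rewrite addKn /= nth_index.
    apply: (determinant_alternate (i1 := j) (i2 := Ordinal iM)).
      by rewrite -val_eqE /= eq_sym.
    by move=> i'; rewrite !mxE /= it nth_cat ltnn subnn.
  rewrite mulr0; move: tpu; rewrite mem_cat => /orP[] tp.
    by rewrite (big_rem t tp) /= subrr; ring.
  by rewrite [\prod_(b <- us) _](big_rem t tp) /= subrr; ring.
have xi_div k l : xi k / rho != xi l.
  apply/eqP => E; have {E} : xi l * rho = xi k by rewrite -E divfK.
  case: (eqVneq l k) => [->|/xi_rho_xi/eqP //]; move/eqP.
  by rewrite -{2}[xi k]mulr1 (inj_eq (mulfI (xi_neq0 k))) (negbTE rho_neq1).
apply: (@is_poly_unique _ (L + M).-1 _ _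
  ((pre ++ us) ++ map xi qs ++ map (fun k => xi k / rho) ps)).
- apply: (is_poly_ext (f := fun t => \prod_(a <- pre) (t - a) *
     (\prod_(b <- us) (b - t) * (P * W *
        correl (ket1 F L)^T (enum 'I_L) (pre ++ t :: us) vs)))).
    by move=> t; rewrite /f; ring.
  have -> : (L + M).-1 = (1 * size pre + (1 * size us + size (enum 'I_L)))%N.
    by rewrite size_enum_ord spre; lia.
  apply: is_polyM.
    apply: is_poly_prod => a; apply: is_poly_ext (is_poly_lin 1 (- a)) => t.
    by rewrite mul1r.
  apply: is_polyM; last by apply: is_polyZ; apply: is_poly_correl.
  apply: is_poly_prod => a; apply: is_poly_ext (is_poly_lin (-1) a) => t; ring.
- apply: is_polyZ; apply: (is_poly_ext (f := fun t => \sum_(i < M)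
     h i t * cofactor (slavnov_mx (pre ++ 0 :: us)) j i)).
    move=> t; rewrite (expand_det_row _ j); apply: eq_bigr => i _.
    congr (_ * _); first by rewrite mxE nth_cat ltnn subnn.
    rewrite /cofactor; congr (_ * \det _); apply/matrixP => i1 j1; rewrite !mxE.
    by rewrite [in RHS]nth_eq //= /bump; case: leqP; lia.
  by apply: is_poly_sum => i _; apply: is_polyZr.
- rewrite !cat_uniq Uus' andbT (map_inj_uniq xi_inj) Ups (map_inj_uniq xi_inj) Uqs.
  rewrite map_inj_uniq ?Ups ?andbT /=; last first.
    by move=> a b; move/(mulIf (invr_neq0 rho_neq0)) => /xi_inj.
  apply/and3P; split.
  + apply/hasPn => a /usx' ax; apply/mapP => -[l _ /eqP].
    by rewrite (negbTE (proj1 (ax l))).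
  + rewrite has_cat negb_or; apply/andP; split; apply/hasPn => a /mapP[k kin ->].
      rewrite /= mem_cat negb_or; apply/andP; split.
        apply/mapP => -[l lps /xi_inj kl]; move: kin.
        by rewrite mem_filter kl /= lps.
      by apply/negP => /usx'/(_ k)[]; rewrite eqxx.
    rewrite /= mem_cat negb_or; apply/andP; split.
      apply/mapP => -[l _ kl]; have := xi_div k l; rewrite kl eqxx //.
    apply/negP => /usx'/(_ k)[_]; by rewrite divfK // eqxx.
  + apply/hasPn => a /mapP[k kin ->]; apply/mapP => -[l _ kl].
    by have := xi_div k l; rewrite kl eqxx.
- rewrite !size_cat !size_map (addnC (size ps + size us)%N) (addnC (size qs)).
  by rewrite sqs -[in (L + M)%N]sus addnS leqnn.
move=> t; rewrite mem_cat => /orP[/node_eq0 //|]; rewrite mem_cat => /orP[].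
  case/mapP => k; rewrite mem_filter /= => /andP[kps _] ->.
  have := IH (rcons ps k) Uus' usx'.
  rewrite rcons_uniq kps Ups size_rcons => /(_ isT); rewrite addSn sus => /(_ erefl).
  by rewrite map_rcons cat_rcons -/pre pairprod_cat_cons; apply.
case/mapP => k kps ->; rewrite /f /g.
have uk : xi k / rho * rho = xi k by rewrite divfK.
rewrite (correl_string_eq0 _ _ Ups kps uk) mul0r.
have kp : (index k ps < size ps)%N by rewrite index_mem.
have ik : (index k ps < M)%N by rewrite -sus ltnS (leq_trans (ltnW kp)) ?leq_addr.
rewrite (slavnov_mx_eq0 (k := k) (j := Ordinal ik) (j' := j) (u := xi k / rho)) ?mulr0 //.
- by rewrite -val_eqE /= spre neq_ltn kp.
- by rewrite /= nth_cat size_map kp (nth_map k) // nth_index.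
- by rewrite /= nth_cat ltnn subnn.
Qed.
End Core.

(** * Removing the twists and the square roots *)

Section Gauge.
Variables (F : fieldType) (rho s : F) (L : nat) (inh : 'I_L -> spectral F).
Notation op := (qop F L).
Notation conf := {ffun 'I_L -> 'I_2}.
Notation dim := #|{: conf}|.
Notation xi := (fun k => rapidity (inh k)).
Notation mon := (mon rho xi).
Implicit Types (l : spectral F) (k : 'I_L) (ks : seq 'I_L) (x y : conf).
Implicit Types (a b c : 'I_2).

Hypothesis s_sq : s ^+ 2 = rho.
Hypothesis s_neq0 : s != 0.
Hypothesis inh_sq : forall k, sqrt_rapidity (inh k) ^+ 2 = rapidity (inh k).
Hypothesis inh_tw : forall k, sqrt_twist (inh k) ^+ 2 = twist (inh k).
Hypothesis inh_sq0 : forall k, sqrt_rapidity (inh k) != 0.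
Hypothesis inh_tw0 : forall k, sqrt_twist (inh k) != 0.

Definition regular l := [/\ sqrt_rapidity l ^+ 2 = rapidity l,
  sqrt_twist l ^+ 2 = twist l, sqrt_rapidity l != 0, sqrt_twist l != 0
  & forall k, rapidity l * rho - xi k != 0].

Definition rprod l ks : 'M[op]_2 := \prod_(k <- ks) Raux rho s l inh k.

(** The index 1 stands for e_2, so this counts the sites of [ks] in state e_2. *)
Definition occ ks x := (\sum_(k <- ks) x k)%N.

Definition gtwist ks := \prod_(k <- ks) (twist (inh k) / s).

(* The diagonal operator conjugating the monodromy matrix; it cancels between
   the two vacua.  The twists enter it because the auxiliary state left of a site
   is fixed by the conservation of the number of e_2. *)
Fixpoint gdiag ks x : F :=
  if ks is k :: ks' then
    gdiag ks' x * (twist (inh k) / s) ^+ occ ks' x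
      * (sqrt_twist (inh k) * sqrt_rapidity (inh k)) ^+ x k
  else 1.

(** The powers of [sqrt_rapidity l] telescope along the auxiliary line and the site roots form a
    quotient of final by initial state. Only [(twist (inh k) / s) ^+ c] retains an internal
    auxiliary state. *)
Lemma Rmatrix_wt l k (a i c j : 'I_2) : regular l ->
  Rmatrix rho s l (inh k) (mxtens_index (a, i)) (mxtens_index (c, j))
  = (twist (inh k) / s) ^+ c * sqrt_rapidity l ^+ c / sqrt_rapidity l ^+ a
    * s ^+ i / sqrt_twist l ^+ (i + j)
    * (sqrt_twist (inh k) * sqrt_rapidity (inh k)) ^+ j
    / (sqrt_twist (inh k) * sqrt_rapidity (inh k)) ^+ i
    * wt rho (rapidity l) (xi k) a i c j / (rapidity l * rho - xi k).
Proof.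
case=> e1 e2 n1 n2 n3; have := n3 k; have := inh_sq0 k; have := inh_tw0 k.
rewrite /Rmatrix mxE -!inh_sq -!inh_tw -e1 -e2 -s_sq => m1 m2 m3.
have m4 : sqrt_rapidity l ^+ 2 * (s * s) - sqrt_rapidity (inh k) ^+ 2 != 0.
  by rewrite -expr2.
have m5 : (sqrt_rapidity l * s) ^+ 2 - sqrt_rapidity (inh k) ^+ 2 != 0.
  by rewrite exprMn.
elim/ord2_ind: a; elim/ord2_ind: i; elim/ord2_ind: c; elim/ord2_ind: j; rewrite /=;
  rewrite ?mulr0 ?mul0r //; field; rewrite ?s_neq0 ?n1 ?n2 ?m1 ?m2 ?m3 ?m4 ?m5 ?oner_eq0 //.
Qed.

Lemma occ_upd k c ks x : k \notin ks -> occ ks (upd x k c) = occ ks x.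
Proof.
move=> kks; rewrite /occ; apply: eq_big_seq => q qks; rewrite ffunE.
by case: eqP => // qk; rewrite qk (negbTE kks) in qks.
Qed.

Lemma gdiag_upd k c ks x : k \notin ks -> gdiag ks (upd x k c) = gdiag ks x.
Proof.
elim: ks => //= q ks IH; rewrite inE negb_or => /andP[kq kks].
by rewrite IH // occ_upd // ffunE eq_sym (negbTE kq).
Qed.

Lemma gdiag_neq0 ks x : gdiag ks x != 0.
Proof.
elim: ks => /= [|k ks IH]; first by rewrite oner_eq0.
have z0 : twist (inh k) != 0 by rewrite -inh_tw expf_neq0.
by rewrite !mulf_neq0 ?expf_neq0 ?mulf_neq0 ?invr_eq0.
Qed.

Lemma mon_consE k ks u a b x y :
  mon (k :: ks) u a b (enum_rank x) (enum_rank y)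
  = \sum_(c : 'I_2) \sum_(i : 'I_2) wt rho u (xi k) a (x k) c i
      * mon ks u c b (enum_rank (upd x k i)) (enum_rank y).
Proof.
rewrite mon_cons summxE; apply: eq_bigr => c _; rewrite site_op_mull.
by apply: eq_bigr => i _; rewrite blkE.
Qed.

Lemma rprod_consE l k ks a b x y :
  rprod l (k :: ks) a b (enum_rank x) (enum_rank y)
  = \sum_(c : 'I_2) \sum_(i : 'I_2) Rmatrix rho s l (inh k) (mxtens_index (a, x k)) (mxtens_index (c, i))
      * rprod l ks c b (enum_rank (upd x k i)) (enum_rank y).
Proof.
have -> : rprod l (k :: ks) a b = \sum_c site_op k (\matrix_(i, j)
    Rmatrix rho s l (inh k) (mxtens_index (a, i)) (mxtens_index (c, j)))
      *m rprod l ks c b.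
  rewrite /rprod big_cons mxE; apply: eq_bigr => c _.
  by rewrite [Raux _ _ _ _ _ _ _]mxE.
rewrite summxE; apply: eq_bigr => c _; rewrite site_op_mull.
by apply: eq_bigr => i _; rewrite mxE.
Qed.

(** Ice rule: each nonzero weight satisfies [a + i = b + j], and these equations add up along the
    chain. *)
Lemma mon_support ks u a b x y : uniq ks ->
  mon ks u a b (enum_rank x) (enum_rank y) != 0 ->
  (a + occ ks x)%N = (b + occ ks y)%N /\ forall k, k \notin ks -> x k = y k.
Proof.
elim: ks a x => [|k ks IH] a x.
  rewrite mon_nil /occ !big_nil => _; case: (eqVneq a b) => [->|]; last by rewrite mxE eqxx.
  by rewrite mxE (inj_eq enum_rank_inj); case: (x =P y) => [->|]; rewrite ?eqxx.
move=> /andP[kks Uks]; rewrite mon_consE => nz.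
have /existsP[c /existsP[i cinz]] : [exists c : 'I_2, [exists i : 'I_2,
    wt rho u (xi k) a (x k) c i
    * mon ks u c b (enum_rank (upd x k i)) (enum_rank y) != 0]].
  apply: contraNT nz => no.
  rewrite big1 // => c _; rewrite big1 // => i _; apply/eqP.
  apply: contraNT no => h; by apply/existsP; exists c; apply/existsP; exists i.
move: cinz; rewrite mulf_eq0 negb_or => /andP[wnz /(IH _ _ Uks)[cE offE]].
have iE : i = y k by have := offE k kks; rewrite ffunE eqxx.
rewrite occ_upd // in cE; split.
  rewrite /occ !big_cons -!/(occ _ _) addnCA [RHS]addnCA -cE -iE.
  move: wnz; move: (x k) => p; clear.
  elim/ord2_ind: a; elim/ord2_ind: p; elim/ord2_ind: c; elim/ord2_ind: i => //=;
   rewrite ?eqxx // => _; lia.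
move=> q; rewrite inE negb_or => /andP[qk qks].
by have := offE q qks; rewrite ffunE (negbTE qk).
Qed.

Lemma rprod_gauge l ks a b x y : regular l -> uniq ks ->
  rprod l ks a b (enum_rank x) (enum_rank y)
  = gtwist ks ^+ b * sqrt_rapidity l ^+ b / sqrt_rapidity l ^+ a
    * s ^+ occ ks x / sqrt_twist l ^+ (occ ks x + occ ks y)
    * (gdiag ks y / gdiag ks x)
    * mon ks (rapidity l) a b (enum_rank x) (enum_rank y)
    / \prod_(k <- ks) (rapidity l * rho - xi k).
Proof.
move=> lreg; have [e1 e2 n1 n2 n3] := lreg.
elim: ks a x => [|k ks IH] a x.
  move=> _; rewrite /rprod /gtwist /occ !big_nil mon_nil mxE /= !expr1n.
  case: (eqVneq a b) => [->|]; last by rewrite !mxE mulr0 mul0r.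
  rewrite [1%:M _ _]mxE.
  by rewrite addn0 expr0 !mulr1 !divr1 mul1r divff ?mul1r ?expf_neq0.
move=> /andP[kks Uks]; rewrite rprod_consE mon_consE.
rewrite !mulr_sumr mulr_suml; apply: eq_bigr => c _.
rewrite !mulr_sumr mulr_suml; apply: eq_bigr => i _.
rewrite (IH _ _ Uks) occ_upd // gdiag_upd //.
case: (eqVneq (mon ks (rapidity l) c b (enum_rank (upd x k i)) (enum_rank y)) 0).
  by move=> ->; rewrite !(mulr0, mul0r).
move/(mon_support Uks); rewrite occ_upd // => -[cE /(_ _ kks)].
rewrite ffunE eqxx => yk.
rewrite (Rmatrix_wt _ _ _ _ _ lreg) /gtwist !big_cons /= -!/(occ _ _) -yk.
have z0 q : twist (inh q) / s != 0.
  by rewrite mulf_neq0 ?invr_eq0 // -inh_tw expf_neq0.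
(* Conservation on the tail eliminates the internal state [c]: the exponent [b] goes into [gtwist],
   the two occupation numbers into [gdiag]. *)
have zE : (twist (inh k) / s) ^+ c * (twist (inh k) / s) ^+ occ ks x
   = (twist (inh k) / s) ^+ b * (twist (inh k) / s) ^+ occ ks y.
  by rewrite -!exprD cE.
have {zE} zE : (twist (inh k) / s) ^+ c
  = (twist (inh k) / s) ^+ b * (twist (inh k) / s) ^+ occ ks y
   / (twist (inh k) / s) ^+ occ ks x.
  by rewrite -zE mulfK // expf_neq0.
have ocE t : occ (k :: ks) t = (t k + occ ks t)%N by rewrite /occ big_cons.
rewrite zE !ocE -yk [(_ * \prod_(j <- ks) _) ^+ b]exprMn !exprD.
set Z := twist (inh k) / s.
set q := sqrt_twist (inh k) * sqrt_rapidity (inh k).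
have q0 : q != 0 by rewrite mulf_neq0.
have := gdiag_neq0 ks x; have := n3 k; rewrite -/q.
have : \prod_(j <- ks) (rapidity l * rho - rapidity (inh j)) != 0.
  by rewrite prodf_seq_neq0; apply/allP => j _; apply: n3.
have := expf_neq0 (x k) q0; have := expf_neq0 (occ ks x) (z0 k : Z != 0).
have := expf_neq0 a n1; have := expf_neq0 c n1.
have := expf_neq0 (x k) n2; have := expf_neq0 i n2.
have := expf_neq0 (occ ks x) n2; have := expf_neq0 (occ ks y) n2.
set p1 := sqrt_twist l ^+ occ ks y; set p2 := sqrt_twist l ^+ occ ks x.
set p3 := sqrt_twist l ^+ i; set p4 := sqrt_twist l ^+ x k.
set p5 := sqrt_rapidity l ^+ c; set p6 := sqrt_rapidity l ^+ a.
set p7 := Z ^+ occ ks x; set p8 := q ^+ x k.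
move: (\prod_(j <- ks) _) (rapidity l * rho - _) (gdiag ks x) (wt _ _ _ _ _ _ _)
  (mon _ _ _ _ _ _) (s ^+ x k) (q ^+ i) => d1 d2 d3 d4 d5 d6 d7.
move=> h1 h2 h3 h4 h5 h6 h7 h8 h9 h10 h11.
by field; rewrite ?h1 ?h2 ?h3 ?h4 ?h5 ?h6 ?h7 ?h8 ?h9 ?h10 ?h11.
Qed.

Notation KS := (rev (enum 'I_L)).

Lemma uniq_KS : uniq KS. Proof. by rewrite rev_uniq enum_uniq. Qed.

(* [w'] arises from [w] by the gauge transformation, and [w] is supported on
   configurations with [n] sites in the state e_2. *)
Definition gauged (w' w : 'rV[F]_dim) (al : F) (n : nat) : Prop :=
  forall x, w' 0 (enum_rank x) = al * gdiag KS x * w 0 (enum_rank x)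
  /\ (w 0 (enum_rank x) != 0 -> occ KS x = n).

(** Here [n] counts the sites in state e_2 before the operator acts. A [B] lowers the count by one
    and a [C] raises it, whence [n + n.-1] and [n + n.+1]. *)
Definition factorB l n := gtwist KS * sqrt_rapidity l * s ^+ n
  / sqrt_twist l ^+ (n + n.-1) / \prod_(k <- KS) (rapidity l * rho - xi k).

Definition factorC l n := s ^+ n / sqrt_rapidity l
  / sqrt_twist l ^+ (n + n.+1) / \prod_(k <- KS) (rapidity l * rho - xi k).

Lemma gauged_mul w' w al n l a b m : regular l -> gauged w' w al n ->
  (a + n = b + m)%N ->
  gauged (w' *m rprod l KS a b) (w *m mon KS (rapidity l) a b)
    (al * (gtwist KS ^+ b * sqrt_rapidity l ^+ b / sqrt_rapidity l ^+ a
      * s ^+ n / sqrt_twist l ^+ (n + m)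
      / \prod_(k <- KS) (rapidity l * rho - xi k))) m.
Proof.
move=> lreg gw anbm y.
have supp x : w 0 (enum_rank x) * mon KS (rapidity l) a b (enum_rank x) (enum_rank y) != 0 ->
    occ KS x = n /\ occ KS y = m.
  rewrite mulf_eq0 negb_or => /andP[/(proj2 (gw x)) xn /(mon_support uniq_KS)[E _]].
  by split => //; move: E; rewrite xn anbm => /addnI.
split; rewrite mulmx_conf.
  rewrite mulmx_conf mulr_sumr; apply: eq_bigr => x _.
  rewrite (proj1 (gw x)) (rprod_gauge a b x y lreg uniq_KS).
  case: (eqVneq (w 0 (enum_rank x) * mon KS (rapidity l) a b (enum_rank x) (enum_rank y)) 0).
    move=> E; rewrite E mulr0.
    transitivity (al * gdiag KS x * (gtwist KS ^+ b * sqrt_rapidity l ^+ b / sqrt_rapidity l ^+ a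
      * s ^+ occ KS x / sqrt_twist l ^+ (occ KS x + occ KS y) * (gdiag KS y / gdiag KS x)
      / \prod_(k <- KS) (rapidity l * rho - xi k)) *
      (w 0 (enum_rank x) * mon KS (rapidity l) a b (enum_rank x) (enum_rank y))).
      by ring.
    by rewrite E mulr0.
  move=> /supp[-> ->].
  have [_ _ n1 n2 n3] := lreg; have := gdiag_neq0 KS x.
  have : \prod_(k <- KS) (rapidity l * rho - rapidity (inh k)) != 0.
    by rewrite prodf_seq_neq0; apply/allP => k _; apply: n3.
  have := expf_neq0 a n1; have := expf_neq0 (n + m) n2.
  set t1 := sqrt_twist l ^+ (n + m); set t2 := sqrt_rapidity l ^+ a.
  move: (\prod_(k <- KS) _) (gdiag KS x) => t3 t4 h1 h2 h3 h4.
  by field; rewrite h1 h2 h3 h4.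
move=> nz; have /existsP[x /supp[]] : [exists x, w 0 (enum_rank x) *
    mon KS (rapidity l) a b (enum_rank x) (enum_rank y) != 0].
  apply: contraNT nz => no; rewrite big1 // => x _; apply/eqP.
  by apply: contraNT no => h; apply/existsP; exists x.
by [].
Qed.

Lemma gauged_B w' w al n l : regular l -> gauged w' w al n.+1 ->
  gauged (w' *m Bop rho s inh l) (w *m mon KS (rapidity l) 0 1)
    (al * factorB l n.+1) n.
Proof.
move=> lreg /(gauged_mul lreg (a := 0) (b := 1) (m := n)) => /(_ erefl).
by rewrite /factorB !expr1 expr0 divr1.
Qed.

Lemma gauged_C w' w al n l : regular l -> gauged w' w al n ->
  gauged (w' *m Cop rho s inh l) (w *m mon KS (rapidity l) 1 0)
    (al * factorC l n) n.+1.
Proof.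
move=> lreg /(gauged_mul lreg (a := 1) (b := 0) (m := n.+1)) => /(_ erefl).
by rewrite /factorC !expr0 !mul1r expr1 [_^-1 * s ^+ n]mulrC.
Qed.

Fixpoint coefB ls n :=
  if ls is l :: ls' then factorB l (size ls + n) * coefB ls' n else 1.

Fixpoint coefC ls n :=
  if ls is l :: ls' then factorC l n * coefC ls' n.+1 else 1.

Lemma gauged_foldB (I : Type) (r : seq I) (f : I -> spectral F) w' w al n :
  (forall i, regular (f i)) -> gauged w' w al (size r + n) ->
  gauged (foldl (fun w i => w *m Bop rho s inh (f i)) w' r)
    (mons rho xi w KS 0 1 (map (fun i => rapidity (f i)) r))
    (al * coefB (map f r) n) n.
Proof.
move=> freg; elim: r w' w al => [|i r IH] w' w al /=; first by rewrite mulr1.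
move=> gw; have := IH _ _ _ (gauged_B (freg i) gw).
by rewrite size_map mulrA.
Qed.

Lemma gauged_foldC (I : Type) (r : seq I) (f : I -> spectral F) w' w al n :
  (forall i, regular (f i)) -> gauged w' w al n ->
  gauged (foldl (fun w i => w *m Cop rho s inh (f i)) w' r)
    (mons rho xi w KS 1 0 (map (fun i => rapidity (f i)) r))
    (al * coefC (map f r) n) (size r + n).
Proof.
move=> freg; elim: r w' w al n => [|i r IH] w' w al n /=; first by rewrite mulr1.
move=> gw; have := IH _ _ _ _ (gauged_C (freg i) gw).
by rewrite mulrA addnS.
Qed.

Lemma coefB_enum M (f : 'I_M -> spectral F) n :
  coefB (map f (enum 'I_M)) n = \prod_(i < M) factorB (f i) (M + n - i).
Proof.
elim: M f => [|M IH] f; first by rewrite big_ord0 (size0nil (size_enum_ord 0)).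
rewrite enum_ordSl /= size_map -map_comp IH big_ord_recl size_map size_enum_ord.
by congr (_ * _); apply: eq_bigr => i _; rewrite lift0 addSn subSS.
Qed.

Lemma coefC_enum M (f : 'I_M -> spectral F) n :
  coefC (map f (enum 'I_M)) n = \prod_(i < M) factorC (f i) (n + i).
Proof.
elim: M f n => [|M IH] f n; first by rewrite big_ord0 (size0nil (size_enum_ord 0)).
rewrite enum_ordSl /= -map_comp IH big_ord_recl addn0.
by congr (_ * _); apply: eq_bigr => i _; rewrite lift0 addnS addSn.
Qed.

Lemma rev_enum_ord M : rev (enum 'I_M) = map (@rev_ord M) (enum 'I_M).
Proof.
apply: (inj_map val_inj); rewrite map_rev val_enum_ord -map_comp.
apply: (@eq_from_nth _ 0%N).
  by rewrite size_rev size_iota size_map size_enum_ord.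
rewrite size_rev size_iota => i iM.
rewrite nth_rev ?size_iota // nth_iota; last by lia.
rewrite (nth_map (Ordinal iM)) ?size_enum_ord //= (nth_ord_enum _ (Ordinal iM)) /=.
by rewrite add0n.
Qed.

Lemma foldl_mulmx (I : Type) (r : seq I) (X : I -> op) (w : 'rV[F]_dim) :
  w *m (\prod_(i <- r) X i : op) = foldl (fun w i => w *m X i) w r.
Proof.
elim: r w => [|i r IH] w; first by rewrite big_nil mulmx1.
by rewrite big_cons /= -IH mulmxA.
Qed.

Lemma scalar_product_gauge M (l l' : 'I_M -> spectral F) : (M <= L)%N ->
  (forall i, regular (l i)) -> (forall i, regular (l' i)) ->
  scalar_product rho s inh l l'
  = \prod_(i < M) (factorB (l i) (L - i) * factorC (l' i) (L - i.+1))
    * correl rho xi (ket1 F L)^T KS (map (fun i => rapidity (l i)) (enum 'I_M))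
        (map (fun i => rapidity (l' (rev_ord i))) (enum 'I_M)).
Proof.
move=> ML lreg lreg'; pose one : conf := [ffun=> 1].
(* The left vacuum starts with L sites in state e_2. The inverse gauge factor taken here cancels the
   one produced at the right vacuum. *)
have bra_g : gauged (ket1 F L)^T (ket1 F L)^T (gdiag KS one)^-1
    (size (enum 'I_M) + (L - M)).
  move=> x; rewrite !mxE enum_rankK -/one; split.
    case: (eqVneq x one) => [->|]; last by rewrite mulr0.
    by rewrite mulVf ?mul1r // gdiag_neq0.
  case: (eqVneq x one) => [-> _|]; last by rewrite eqxx.
  rewrite size_enum_ord subnKC // /occ (eq_bigr (fun=> 1%N)) => [|k _]; last by rewrite ffunE.
  by rewrite sum1_size size_rev size_enum_ord.
have := gauged_foldC (map (@rev_ord M) (enum 'I_M)) lreg' (gauged_foldB lreg bra_g).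
move=> /(_ one)[E _].
have revE (T : Type) (f : 'I_M -> T) :
    map (fun i => f (rev_ord i)) (enum 'I_M) = map f (map (@rev_ord M) (enum 'I_M)).
  by rewrite -map_comp.
rewrite (revE _ (fun i => rapidity (l' i))).
rewrite /scalar_product rev_enum_ord !foldl_mulmx /correl mulmx_conf (bigD1 one) //= big1 ?addr0; last first.
  by move=> x /negbTE x1; rewrite [ket1 _ _ _ _]mxE enum_rankK x1 mulr0.
rewrite E [ket1 _ _ _ _]mxE enum_rankK eqxx mulr1 mulmx_conf.
rewrite (bigD1 one) //= [X in _ + X]big1 ?addr0; last first.
  by move=> x /negbTE x1; rewrite [ket1 _ _ _ _]mxE enum_rankK x1 mulr0.
rewrite [ket1 _ _ _ _]mxE enum_rankK eqxx mulr1; congr (_ * _).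
rewrite coefB_enum -revE (coefC_enum (fun i => l' (rev_ord i))) [RHS]big_split.
rewrite [X in _ = _ * X](reindex_inj rev_ord_inj).
rewrite subnKC // mulrC !mulrA divff ?mul1r ?gdiag_neq0 //; congr (_ * _).
by apply: eq_bigr => i _; congr factorC; have := ltn_ord i; rewrite /=; lia.
Qed.
End Gauge.

(** * Signs, powers of the square roots, and the final formula *)

Lemma det_rows_perm (F : fieldType) n (sg : {perm 'I_n}) (A : 'M[F]_n) :
  \det (\matrix_(i, j) A (sg i) j) = (-1) ^+ sg * \det A.
Proof.
rewrite (_ : \matrix_(i, j) _ = row_perm sg A).
  by rewrite row_permE det_mulmx det_perm.
by apply/matrixP => i j; rewrite !mxE.
Qed.

(** The product is a Vandermonde determinant in the negated variables, the negation accounting for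
    the orientation of the differences; permuting the variables permutes its columns. *)
Lemma prod_diff_perm (F : fieldType) n (sg : {perm 'I_n}) (a : 'I_n -> F) :
  \prod_(i < n) \prod_(j < n | (i < j)%N) (a (sg i) - a (sg j))
  = (-1) ^+ sg * \prod_(i < n) \prod_(j < n | (i < j)%N) (a i - a j).
Proof.
have V b : \prod_(i < n) \prod_(j < n | (i < j)%N) (b i - b j)
    = \det (Vandermonde n (\row_(i < n) - (b i : F))).
  rewrite det_Vandermonde; apply: eq_bigr => i _; apply: eq_bigr => j _.
  by rewrite !mxE; ring.
rewrite (V (fun i => a (sg i))) V -det_tr -[in RHS]det_tr -det_rows_perm.
by congr (\det _); apply/matrixP => i j; rewrite !mxE.
Qed.

Lemma pairprod_enum (F : fieldType) n (f : F -> F -> F) (a : 'I_n -> F) :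
  pairprod f (map a (enum 'I_n))
  = \prod_(i < n) \prod_(j < n | (i < j)%N) f (a i) (a j).
Proof.
have nthE (i : 'I_n) : (map a (enum 'I_n))`_i = a i.
  by rewrite (nth_map i) ?size_enum_ord // nth_ord_enum.
transitivity (\prod_(i < n) \prod_(j < n | (i < j)%N)
    f (map a (enum 'I_n))`_i (map a (enum 'I_n))`_j).
  rewrite pairprod_nth.
  have -> : size (map a (enum 'I_n)) = n by rewrite size_map size_enum_ord.
  by [].
by apply: eq_bigr => i _; apply: eq_bigr => j _; rewrite !nthE.
Qed.

(** The exponents sum to 2 L M - M^2. The part L M cancels the M factors [s ^- L] contained in
    [gtwist]; the rest is the power of [rho] in the theorem. *)
Lemma prod_srho (F : fieldType) (s : F) (L M : nat) : s != 0 -> (M <= L)%N ->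
  \prod_(i < M) (s ^+ (L - i) * s ^+ (L - i.+1)) = s ^+ (L * M) * s ^+ (M * (L - M)).
Proof.
move=> s0; elim: M => [|M IH] ML; first by rewrite big_ord0 muln0 mul0n mulr1.
rewrite big_ord_recr /= IH 1?ltnW // -!exprD; congr (_ ^+ _).
have -> : L = (M.+1 + (L - M.+1))%N by rewrite subnKC.
move: (L - M.+1)%N => d; rewrite addKn.
have -> : (M.+1 + d - M = d.+1)%N by lia.
nia.
Qed.

Theorem mainTheorem6 (R : realType) (rho srho : R[i])
    (rho_neq0 : rho != 0) (rho_neq1 : rho != 1)
    (L M : nat) (M_gt0 : (1 <= M)%N) (M_leL : (M <= L)%N)
    (mu x nu y : 'I_M -> R[i]) (xi z : 'I_L -> R[i])
    (* the fixed square roots *)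
    (smu sx snu sy : 'I_M -> R[i]) (sxi sz : 'I_L -> R[i])
    (srhoE : srho ^+ 2 = rho)
    (smuE : forall m, smu m ^+ 2 = mu m) (sxE : forall m, sx m ^+ 2 = x m)
    (snuE : forall m, snu m ^+ 2 = nu m) (syE : forall m, sy m ^+ 2 = y m)
    (sxiE : forall k, sxi k ^+ 2 = xi k) (szE : forall k, sz k ^+ 2 = z k)
    (* nonzero entries *)
    (mu_neq0 : forall m, mu m != 0) (x_neq0 : forall m, x m != 0)
    (nu_neq0 : forall m, nu m != 0) (y_neq0 : forall m, y m != 0)
    (xi_neq0 : forall k, xi k != 0) (z_neq0 : forall k, z k != 0)
    (* genericity *)
    (mu_inj : injective mu) (nu_inj : injective nu) (xi_inj : injective xi)
    (mu_nu : forall i j, mu i != nu j)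
    (mu_xi : forall i k, mu i != xi k) (nu_xi : forall i k, nu i != xi k)
    (mu_rho_xi : forall i k, mu i * rho != xi k)
    (nu_rho_xi : forall i k, nu i * rho != xi k)
    (xi_rho_xi : forall j k, j != k -> xi j * rho != xi k)
    (* the Bethe equations *)
    (bethe : forall j : 'I_M,
       (\prod_(k < L) ((xi k - nu j) / (xi k - nu j * rho)))
         * (\prod_(m < M | m != j) (nu m - nu j * rho))
       = srho ^- L * (\prod_(k < L) z k)
         * (\prod_(m < M | m != j) (nu m * rho - nu j))) :
  scalar_product rho srho
    (fun k : 'I_L => Spectral (xi k) (z k) (sxi k) (sz k))
    (fun m : 'I_M => Spectral (mu m) (x m) (smu m) (sx m))
    (fun m : 'I_M => Spectral (nu m) (y m) (snu m) (sy m))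
  = (\prod_(n < L) z n ^+ M)
      (* (x_m y_m)^(L + 1/2 - m) with m = i + 1, an odd power of the roots *)
      / (\prod_(i < M) (sx i * sy i) ^+ (2 * L + 1 - 2 * i.+1))
    * (srho ^+ (M * (L - M)) * (\prod_(k < M) (smu k * snu k))
       / (\prod_(q < M) \prod_(l < M | (q < l)%N)
            ((mu l - mu q) * (nu q - nu l))))
    * \det (\matrix_(i < M, j < M)
        ((rho - 1) / (nu i - mu j)
         * (srho ^- L * (\prod_(k < L) z k)
              * (\prod_(m < M | m != i) (nu m * rho - mu j))
            - (\prod_(k < L) ((mu j - xi k) / (mu j * rho - xi k)))
              * (\prod_(m < M | m != i) (nu m - mu j * rho))))).
Proof.
have root_neq0 (a b : R[i]) : a ^+ 2 = b -> b != 0 -> a != 0.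
  by move=> <-; rewrite expf_eq0.
have s0 := root_neq0 _ _ srhoE rho_neq0.
have smu0 m := root_neq0 _ _ (smuE m) (mu_neq0 m).
have snu0 m := root_neq0 _ _ (snuE m) (nu_neq0 m).
have sx0 m := root_neq0 _ _ (sxE m) (x_neq0 m).
have sy0 m := root_neq0 _ _ (syE m) (y_neq0 m).
have sxi0 k := root_neq0 _ _ (sxiE k) (xi_neq0 k).
have sz0 k := root_neq0 _ _ (szE k) (z_neq0 k).
set inh := fun k : 'I_L => _.
set l := fun m : 'I_M => Spectral (mu m) _ _ _.
set l' := fun m : 'I_M => Spectral (nu m) _ _ _.
have lreg i : regular rho inh (l i).
  by split => //= k; rewrite subr_eq0.
have lreg' i : regular rho inh (l' i).
  by split => //= k; rewrite subr_eq0.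
rewrite (@scalar_product_gauge _ rho srho _ inh srhoE s0 sxiE szE sxi0 sz0) //.
rewrite (correl_perm xi_rho_xi _ _ (ps := enum 'I_L)); last first.
- by rewrite rev_uniq enum_uniq.
- by rewrite perm_rev.
(* The C operators act in the order nu_M, ..., nu_1. *)
pose sg : {perm 'I_M} := perm (@rev_ord_inj M).
have sgE i : sg i = rev_ord i by rewrite permE.
pose V i := nu (rev_ord i).
pose kappa := srho ^- L * \prod_(k < L) z k.
have kappa_neq0 : kappa != 0.
  by rewrite mulf_neq0 ?invr_eq0 ?expf_neq0 //; apply/prodf_neq0.
have V_inj : injective V by move=> i j /nu_inj/rev_ord_inj.
have prod_rev (f : 'I_M -> R[i]) i :
    \prod_(m < M | m != i) f (rev_ord m) = \prod_(m < M | m != rev_ord i) f m.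
  rewrite [RHS](reindex_inj rev_ord_inj); apply: eq_bigl => m.
  by rewrite (inj_eq rev_ord_inj).
have betheV i : kappa * \prod_(m < M | m != i) (V m * rho - V i)
  = \prod_(k < L) ((V i - xi k) / (V i * rho - xi k))
    * \prod_(m < M | m != i) (V m - V i * rho).
  rewrite /V (prod_rev (fun m => nu m * rho - nu (rev_ord i))).
  rewrite (prod_rev (fun m => nu m - nu (rev_ord i) * rho)) -bethe.
  congr (_ * _); apply: eq_bigr => k _.
  by rewrite -opprB -[xi k - _ * rho]opprB invrN mulrNN.
have V_rho_xi i k : V i * rho != xi k by exact: nu_rho_xi.
(* The Bethe equation for [V i] makes the bracket vanish there, so the pole is removed by dividing
   polynomials. *)
have /fin_all_exists[h hP] i : exists h, is_poly (L + M).-1 h /\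
    forall u, (V i - u) * h u = (rho - 1) * bracket rho xi V kappa i u.
  apply: is_poly_div; last by rewrite (bracket_root V_rho_xi betheV) mulr0.
  rewrite prednK ?ltn_addl //; apply: is_polyZ; apply: is_poly_bracket.
have Umus : uniq (map mu (enum 'I_M)) by rewrite map_inj_uniq // enum_uniq.
have mus_xi u : u \in map mu (enum 'I_M) -> forall k, u != xi k /\ u * rho != xi k.
  by case/mapP => i _ -> k.
have := @scalar_product_core _ rho L xi rho_neq0 rho_neq1 xi_rho_xi xi_inj xi_neq0
  M V kappa V_inj (fun i => nu_neq0 _) (fun i => nu_xi _) V_rho_xi kappa_neq0 betheV
  h (fun i => proj1 (hP i)) (fun i => proj2 (hP i)) (map mu (enum 'I_M)) [::]
  Umus mus_xi isT.
rewrite size_map size_enum_ord => /(_ erefl) /=.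
rewrite !pairprod_enum.
have -> : \prod_(i < M) \prod_(j < M | (i < j)%N) (V i - V j)
    = \prod_(i < M) \prod_(j < M | (i < j)%N) (nu (sg i) - nu (sg j)).
  by apply: eq_bigr => i _; apply: eq_bigr => j _; rewrite !sgE.
rewrite (prod_diff_perm sg nu).
pose nmu i := \prod_(k < L) (mu i * rho - xi k).
pose nnu i := \prod_(k < L) (nu i * rho - xi k).
have nmu0 i : nmu i != 0 by apply/prodf_neq0 => k _; rewrite subr_eq0.
have nnu0 i : nnu i != 0 by apply/prodf_neq0 => k _; rewrite subr_eq0.
set H := \matrix_(i < M, j < M) ((rho - 1) / (nu i - mu j) * _).
have -> : slavnov_mx h (map mu (enum 'I_M))
    = \matrix_(j < M, i < M) (nmu j * (\matrix_(i, j) H (sg i) j)^T j i).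
  apply/matrixP => j i; rewrite !mxE (nth_map i) ?size_enum_ord // nth_ord_enum sgE.
  have Vmu : V i - mu j != 0 by rewrite subr_eq0 eq_sym; exact: mu_nu.
  apply: (mulfI Vmu); rewrite (proj2 (hP i)) /bracket -/(nmu j).
  rewrite (prod_rev (fun m => nu m * rho - mu j)).
  rewrite (prod_rev (fun m => nu m - mu j * rho)).
  rewrite prodf_div -/(nmu j) /kappa; move: Vmu (nmu0 j); rewrite /V.
  move: (nmu j) (nu (rev_ord i)) => d v.
  move: (srho ^- L * _) => ka h1 h2.
  by field; rewrite h1 h2.
rewrite det_row_scale det_tr det_rows_perm.
have -> : \prod_(i < M) V i = \prod_(i < M) nu i.
  by rewrite [RHS](reindex_inj rev_ord_inj).
have -> : \prod_(i < M) \prod_(k < L) (V i * rho - xi k) = \prod_(i < M) nnu i.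
  by rewrite [RHS](reindex_inj rev_ord_inj).
pose pmu := \prod_(i < M) \prod_(j < M | (i < j)%N) (mu j - mu i).
pose pnu := \prod_(i < M) \prod_(j < M | (i < j)%N) (nu i - nu j).
have pmu0 : pmu != 0.
  apply/prodf_neq0 => i _; apply/prodf_neq0 => j ij; rewrite subr_eq0 (inj_eq mu_inj).
  by rewrite -val_eqE gtn_eqF.
have pnu0 : pnu != 0.
  apply/prodf_neq0 => i _; apply/prodf_neq0 => j ij; rewrite subr_eq0 (inj_eq nu_inj).
  by rewrite -val_eqE ltn_eqF.
have -> : \prod_(q < M) \prod_(l < M | (q < l)%N) ((mu l - mu q) * (nu q - nu l))
    = pmu * pnu.
  by rewrite /pmu /pnu -big_split; apply: eq_bigr => i _; rewrite -big_split.
rewrite -/pmu -/pnu => coreE.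
(* The sign of the reversal occurs both in the difference product of the [nu] and in the
   determinant, and cancels. *)
have sg0 : (-1) ^+ sg != 0 :> R[i] by rewrite signr_eq0.
set cor := correl _ _ _ _ _ _ in coreE *.
have {}coreE : cor = \prod_(i < M) nu i * \prod_(i < M) nnu i
    * (\prod_(i < M) nmu i * \det H) / (pmu * pnu).
  apply: (mulIf (mulf_neq0 pmu0 (mulf_neq0 sg0 pnu0))); rewrite coreE.
  by move: ((-1) ^+ sg) sg0 => e e0; field; rewrite pmu0 pnu0.
rewrite coreE {coreE}.
have KSE (f : 'I_L -> R[i]) : \prod_(k <- rev (enum 'I_L)) f k = \prod_(k < L) f k.
  by rewrite (perm_big (enum 'I_L)) ?big_enum // perm_rev.
have -> : \prod_(i < M) (factorB rho srho inh (l i) (L - i)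
      * factorC rho srho inh (l' i) (L - i.+1))
  = \prod_(i < M) (\prod_(k < L) z k / srho ^+ L * (srho ^+ (L - i) * srho ^+ (L - i.+1))
     * smu i / snu i / (sx i * sy i) ^+ (2 * L + 1 - 2 * i.+1) / nmu i / nnu i).
  apply: eq_bigr => i _; rewrite /factorB /factorC /gtwist !KSE /=.
  rewrite prodf_div prodr_const card_ord -/(nmu i) -/(nnu i).
  have iL : (i < L)%N by apply: leq_trans (ltn_ord i) M_leL.
  (* The [B] of index [i] meets L - i sites in state e_2 and the [C] of index [i] meets L - i - 1,
     so both twists get the same odd exponent. *)
  rewrite (_ : L - i + (L - i).-1 = 2 * L + 1 - 2 * i.+1)%N; last by lia.
  rewrite (_ : L - i.+1 + (L - i.+1).+1 = 2 * L + 1 - 2 * i.+1)%N; last by lia.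
  rewrite exprMn; move: (expf_neq0 (2 * L + 1 - 2 * i.+1) (sx0 i))
    (expf_neq0 (2 * L + 1 - 2 * i.+1) (sy0 i)) (expf_neq0 L s0) (nmu0 i) (nnu0 i) (snu0 i).
  move: (sx i ^+ _) (sy i ^+ _) (srho ^+ L) (nmu i) (nnu i) => e1 e2 e3 e4 e5.
  by move=> h1 h2 h3 h4 h5 h6; field; rewrite h1 h2 h3 h4 h5 h6.
have invM (f : 'I_M -> R[i]) : \prod_(i < M) (f i)^-1 = (\prod_(i < M) f i)^-1.
  by rewrite prodfV.
rewrite 6!big_split /= !invM prod_srho // prodr_const card_ord prodrXl.
(* Each [C] leaves one root [snu i] in the denominator; against this square one root survives in the
   numerator. *)
have -> : \prod_(i < M) nu i = (\prod_(i < M) snu i) ^+ 2.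
  by rewrite -prodrXl; apply: eq_bigr => i _; rewrite snuE.
rewrite expr_div_n -exprM [\prod_(k < M) (smu k * snu k)]big_split /=.
have : srho ^+ (L * M) != 0 by rewrite expf_neq0.
have : \prod_(i < M) nmu i != 0 by apply/prodf_neq0.
have : \prod_(i < M) nnu i != 0 by apply/prodf_neq0.
have : \prod_(i < M) snu i != 0 by apply/prodf_neq0.
have : \prod_(i < M) (sx i * sy i) ^+ (2 * L + 1 - 2 * i.+1) != 0.
  by apply/prodf_neq0 => i _; rewrite expf_neq0 // mulf_neq0.
move: (\prod_(i < M) (sx i * sy i) ^+ _) (\prod_(i < M) snu i) (\prod_(i < M) nnu i)
  (\prod_(i < M) nmu i) (srho ^+ (L * M)) (srho ^+ (M * (L - M))) pmu0 pnu0.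
move: pmu pnu => e1 e2 e3 e4 e5 e6 e7 e8 h1 h2 h3 h4 h5 h6 h7.
by field; rewrite ?h1 ?h2 ?h3 ?h4 ?h5 ?h6 ?h7.
Qed.
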